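(* If $1<p<\infty$ and $-\frac{d_k}{p}<\beta<\frac{d_k}{p'}$, then $$\Phi_k=\Bigl\{f\in\mathcal{S}(\mathbb{R}^d)\colon\int_{\mathbb{R}^d}x^nf(x)\,d\mu_k(x)=0\ \text{ for all } n\in\mathbb{Z}_+^d\Bigr\}$$ is dense in $L^p(\mathbb{R}^d,|x|^{\beta p}\,d\mu_k)$.
   Context: $p'=p/(p-1)$; $\mathcal{S}(\mathbb{R}^d)$ is the Schwartz space; $x^n=\prod_jx_j^{n_j}$. $R\subset\mathbb{R}^d\setminus\{0\}$ is a root system: a finite set with $R\cap\mathbb{R}a=\{a,-a\}$ and $\sigma_aR=R$ for all $a\in R$, where $\sigma_a$ is the reflection in the hyperplane $\langle a,x\rangle=0$; $R_+$ is a positive subsystem; $G(R)$ is the finite group generated by the $\sigma_a$; $k\colon R\to[0,\infty)$ is $G(R)$-invariant. Put $$v_k(x)=\prod_{a\in R_+}|\langle a,x\rangle|^{2k(a)},\quad c_k^{-1}=\int_{\mathbb{R}^d}e^{-|x|^2/2}v_k(x)\,dx,\quad d\mu_k(x)=c_kv_k(x)\,dx,$$ $$\lambda_k=\frac d2-1+\sum_{a\in R_+}k(a),\qquad d_k=2\lambda_k+2.$$ *)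

(* Defs.v *)
From HB Require Import structures.
From mathcomp Require Import all_boot all_order all_algebra.
From mathcomp Require Import finmap.
From mathcomp Require Import all_classical all_reals all_analysis.
From mathcomp Require Import measurable_realfun complex.
Set Implicit Arguments.
Unset Strict Implicit.
Unset Printing Implicit Defensive.
Import Order.TTheory GRing.Theory Num.Theory.
Import numFieldNormedType.Exports.
Local Open Scope classical_set_scope.
Local Open Scope ring_scope.

(* The coordinates generate the Borel sigma-algebra of R^n. *)
Definition measure_rV_display : measure_display -> measure_display.
Proof. exact. Qed.

Section measurable_rV.
Context {disp : measure_display} {T : measurableType disp}.
Variable n : nat.

Let coord : 'I_n -> 'rV[T]_n -> T := fun i x => x ord0 i.

Let rV_set0 : g_sigma_preimage coord set0.
Proof. exact: sigma_algebra0. Qed.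

Let rV_setC A : g_sigma_preimage coord A -> g_sigma_preimage coord (~` A).
Proof. exact: sigma_algebraC. Qed.

Let rV_bigcup (F : _^nat) : (forall i, g_sigma_preimage coord (F i)) ->
  g_sigma_preimage coord (\bigcup_i (F i)).
Proof. exact: sigma_algebra_bigcup. Qed.

HB.instance Definition _ := @isMeasurable.Build (measure_rV_display disp)
  'rV[T]_n (g_sigma_preimage coord) rV_set0 rV_setC rV_bigcup.

End measurable_rV.

Lemma measurable_coord {disp : measure_display} {T : measurableType disp}
    (n : nat) (i : 'I_n) :
  measurable_fun [set: 'rV[T]_n] (fun x : 'rV[T]_n => x ord0 i).
Proof.
move=> _ Y mY; rewrite setTI; apply: sub_sigma_algebra => /=.
rewrite -bigcup_seq/=; exists i => /=; first by rewrite mem_index_enum.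
by exists Y => //; rewrite setTI.
Qed.

Lemma measurable_fun_coordP {disp disp' : measure_display}
    {T1 : measurableType disp} {T2 : measurableType disp'} (n : nat)
    (f : T1 -> 'rV[T2]_n) :
  measurable_fun [set: T1] f <->
  forall i, measurable_fun [set: T1] (fun x => f x ord0 i).
Proof.
split=> [mf i|mf].
  by apply: (measurableT_comp (measurable_coord i)).
move=> _ Y; rewrite setTI => mY.
pose G : set (set 'rV[T2]_n) := [set B | measurable (f @^-1` B)].
suff : G Y by [].
move: Y mY; apply: smallest_sub.
  split.
  - by rewrite /G /= preimage_set0.
  - move=> B GB; rewrite /G /= setTD -preimage_setC.
    exact: measurableC.
  - by move=> F mF; rewrite /G /= preimage_bigcup; apply: bigcup_measurable => k _; exact: mF.
rewrite -bigcup_seq => B [i _] [C mC <-]; rewrite /G /= setTI.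
by rewrite -[X in measurable X]setTI; exact: mf.
Qed.

Section lebesgue_rV_def.
Context {R : realType}.

Definition cons_rV (n : nat) (x : R * 'rV[R]_n) : 'rV[R]_n.+1 :=
  row_mx (const_mx x.1 : 'rV[R]_1) x.2.

Definition uncons_rV (n : nat) (x : 'rV[R]_n.+1) : R * 'rV[R]_n :=
  (x ord0 ord0, rsubmx (x : 'rV[R]_(1 + n))).

Lemma cons_rV0 (n : nat) (x : R * 'rV[R]_n) : cons_rV x ord0 ord0 = x.1.
Proof.
rewrite /cons_rV (_ : ord0 = lshift n ord0 :> 'I_(1 + n)); last exact: val_inj.
by rewrite [LHS](@row_mxEl _ 1 1 n) mxE.
Qed.

Lemma cons_rVS (n : nat) (x : R * 'rV[R]_n) (i : 'I_n) :
  cons_rV x ord0 (lift ord0 i) = x.2 ord0 i.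
Proof.
rewrite /cons_rV (_ : lift ord0 i = rshift 1 i :> 'I_(1 + n)).
  by rewrite [LHS](@row_mxEr _ 1 1 n).
exact: val_inj.
Qed.

Lemma cons_rVK (n : nat) : cancel (@cons_rV n) (@uncons_rV n).
Proof. by case=> a v; rewrite /uncons_rV cons_rV0 /cons_rV row_mxKr. Qed.

Lemma measurable_cons_rV (n : nat) : measurable_fun setT (@cons_rV n).
Proof.
apply/measurable_fun_coordP => i.
have [j ->|->] := unliftP ord0 i.
  under eq_fun do rewrite cons_rVS.
  by apply: (measurableT_comp (measurable_coord j)); exact: measurable_snd.
under eq_fun do rewrite cons_rV0.
exact: measurable_fst.
Qed.

Lemma measurable_uncons_rV (n : nat) : measurable_fun setT (@uncons_rV n).
Proof.
apply/measurable_fun_pairP; split; first exact: measurable_coord.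
apply/measurable_fun_coordP => i /=.
by under eq_fun do rewrite mxE; exact: measurable_coord.
Qed.

Definition lebesgue_cons (n : nat)
    (m : {sigma_finite_measure set 'rV[R]_n -> \bar R}) :
    set 'rV[R]_n.+1 -> \bar R :=
  pushforward (lebesgue_measure \x m)%E (@cons_rV n).

Section lebesgue_cons_measure.
Variables (n : nat) (m : {sigma_finite_measure set 'rV[R]_n -> \bar R}).
Local Open Scope ereal_scope.

Let mE A : measurable A -> measurable (@cons_rV n @^-1` A).
Proof.
by move=> mA; rewrite -[X in measurable X]setTI; exact: measurable_cons_rV.
Qed.

Let lebesgue_cons0 : lebesgue_cons m set0 = 0.
Proof. by rewrite /lebesgue_cons /pushforward preimage_set0 measure0. Qed.

Let lebesgue_cons_ge0 A : 0 <= lebesgue_cons m A.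
Proof. by rewrite /lebesgue_cons /pushforward measure_ge0. Qed.

Let lebesgue_cons_sigma_additive : semi_sigma_additive (lebesgue_cons m).
Proof.
move=> F mF tF mUF; rewrite /lebesgue_cons /pushforward preimage_bigcup.
apply: measure_semi_sigma_additive.
- by move=> i; exact: mE.
- apply/trivIsetP => /= i j _ _ ij; rewrite -preimage_setI.
  by move/trivIsetP : tF => /(_ _ _ _ _ ij) ->//; rewrite preimage_set0.
- by rewrite -preimage_bigcup; exact: mE.
Qed.

HB.instance Definition _ := isMeasure.Build _ _ _ (lebesgue_cons m)
  lebesgue_cons0 lebesgue_cons_ge0 lebesgue_cons_sigma_additive.

Let lebesgue_cons_sigma_finite : sigma_finite setT (lebesgue_cons m).
Proof.
have /sigma_finiteP[F [FT ndF Foo]] := sigma_finiteT (@lebesgue_measure R).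
have /sigma_finiteP[G [GT ndG Goo]] := sigma_finiteT m.
exists (fun i => @uncons_rV n @^-1` (F i `*` G i)).
  rewrite -preimage_bigcup (_ : \bigcup_i _ = setT) ?preimage_setT//.
  apply/seteqP; split=> // -[a v] _.
  have [i _ Fia] : (\bigcup_i F i) a by rewrite -FT.
  have [j _ Gjv] : (\bigcup_i G i) v by rewrite -GT.
  exists (maxn i j) => //; split=> /=.
    by move: Fia; exact/subsetPset/ndF/leq_maxl.
  by move: Gjv; exact/subsetPset/ndG/leq_maxr.
move=> i; have [mFi Fioo] := Foo i; have [mGi Gioo] := Goo i.
split.
  rewrite -[X in measurable X]setTI; apply: measurable_uncons_rV => //.
  exact: measurableX.
rewrite /lebesgue_cons /pushforward -comp_preimage.
rewrite (_ : _ \o _ = id) ?preimage_id; last first.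
  by apply/funext => x /=; rewrite cons_rVK.
by rewrite product_measure1E// lte_mul_pinfty// ge0_fin_numE.
Qed.

HB.instance Definition _ := @Measure_isSigmaFinite.Build _ _ _
  (lebesgue_cons m) lebesgue_cons_sigma_finite.

End lebesgue_cons_measure.

(* Lebesgue measure on R^n as the n-fold product of the one on R; its values on
   boxes are given by lebesgue_rV_box below. *)
Fixpoint lebesgue_rV (n : nat) :
    {sigma_finite_measure set 'rV[R]_n -> \bar R} :=
  if n is n'.+1 then lebesgue_cons (lebesgue_rV n') else \d_(0 : 'rV[R]_0).

Lemma lebesgue_rV_box (n : nat) (A : 'I_n -> set R) :
  (forall i, measurable (A i)) ->
  lebesgue_rV n [set x | forall i, A i (x ord0 i)] =
  (\prod_(i < n) lebesgue_measure (A i))%E.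
Proof.
elim: n A => [|n IH] A mA /=.
  rewrite big_ord0 diracE mem_set//; by case.
rewrite big_ord_recl -IH; last by move=> i; exact: mA.
have mB : measurable
    [set x : 'rV[R]_n | forall i, A (lift ord0 i) (x ord0 i)].
  rewrite [X in measurable X](_ : _ = \bigcap_(i in setT)
      ((fun x : 'rV[R]_n => x ord0 i) @^-1` A (lift ord0 i))); last first.
    by apply/seteqP; split=> x /= xA i; [move=> _; exact: xA|exact: xA].
  apply: fin_bigcap_measurable; first exact: finite_finset.
  by move=> i _; rewrite -[X in measurable X]setTI; exact: measurable_coord.
rewrite -product_measure1E//; last exact: mA.
rewrite /lebesgue_cons /pushforward; congr ((_ \x _)%E _).
apply/seteqP; split=> -[a v] /=.
  move=> H; split; first by have := H ord0; rewrite cons_rV0.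
  by move=> i; have := H (lift ord0 i); rewrite cons_rVS.
move=> [Aa Av] i; have [j ->|->] := unliftP ord0 i.
  by rewrite cons_rVS; exact: Av.
by rewrite cons_rV0.
Qed.

End lebesgue_rV_def.

Section density.
Context {disp : measure_display} {T : measurableType disp} {R : realType}.
Variables (mu : {measure set T -> \bar R}) (w : T -> R).
Hypotheses (w_ge0 : forall x, 0 <= w x) (mw : measurable_fun [set: T] w).

(* The two proofs only serve to make with_density canonically a measure. *)
Definition with_density of (forall x, 0 <= w x) & measurable_fun [set: T] w :
    set T -> \bar R := fun A => (\int[mu]_(x in A) (w x)%:E)%E.

Let nu := with_density w_ge0 mw.

Let nu0 : nu set0 = 0%E.
Proof. exact: integral_set0. Qed.

Let nu_ge0 A : (0 <= nu A)%E.
Proof. by apply: integral_ge0 => x _; rewrite lee_fin. Qed.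

Let nu_sigma_additive : semi_sigma_additive nu.
Proof.
move=> F mF tF mUF.
rewrite /nu /with_density ge0_integral_bigcup//; first last.
- by move=> x _; rewrite lee_fin.
- apply/measurable_EFinP; apply: (@measurable_funS _ _ _ _ setT) => //.
by apply: is_cvg_nneseries => i _ _; exact: nu_ge0.
Qed.

HB.instance Definition _ := isMeasure.Build _ _ _ (with_density w_ge0 mw)
  nu0 nu_ge0 nu_sigma_additive.

End density.

Section euclidean.
Context {R : realType} {d : nat}.
Implicit Types (a x y : 'rV[R]_d) (n : 'I_d -> nat).

Definition dot x y : R := \sum_(i < d) x ord0 i * y ord0 i.

(* The norm carried by 'rV[R]_d in the library is the max norm. *)
Definition enorm x : R := Num.sqrt (dot x x).

Definition monomial n x : R := \prod_(i < d) x ord0 i ^+ n i.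

Lemma measurable_dot a : measurable_fun [set: 'rV[R]_d] (dot a).
Proof.
apply: measurable_sum => i.
by apply: measurable_funM => //; exact: measurable_coord.
Qed.

Lemma measurable_enorm : measurable_fun [set: 'rV[R]_d] enorm.
Proof.
apply: (measurableT_comp (f := @Num.sqrt R)).
  apply: continuous_measurable_fun; exact: sqrt_continuous.
apply: measurable_sum => i.
by apply: measurable_funM; exact: measurable_coord.
Qed.

End euclidean.

Section root_systems.
Context {R : realType} {d : nat}.
Implicit Types (A Ap : {fset 'rV[R]_d}) (a x : 'rV[R]_d) (k : 'rV[R]_d -> R).

Definition reflection a x : 'rV[R]_d := x - (2 * dot a x / dot a a) *: a.

Definition root_system A : Prop :=
  [/\ 0 \notin A,
      forall a, a \in A ->
        [set` A] `&` range (fun c : R => c *: a) = [set a; - a] &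
      forall a, a \in A -> reflection a @` [set` A] = [set` A]].

(* A positive subsystem is cut out by an open half-space whose boundary
   hyperplane contains no root. *)
Definition positive_subsystem A Ap : Prop :=
  exists u : 'rV[R]_d, (forall a, a \in A -> dot u a != 0) /\
    [set` Ap] = [set a | a \in A /\ 0 < dot u a].

Inductive reflection_group A : ('rV[R]_d -> 'rV[R]_d) -> Prop :=
| reflection_group_gen a : a \in A -> reflection_group A (reflection a)
| reflection_group_id : reflection_group A id
| reflection_group_comp g h :
    reflection_group A g -> reflection_group A h -> reflection_group A (g \o h)
| reflection_group_inv g h :
    reflection_group A g -> cancel g h -> cancel h g -> reflection_group A h.

(* Only the values of k on A matter. *)
Definition multiplicity A k : Prop :=
  (forall a, a \in A -> 0 <= k a) /\
  (forall g a, reflection_group A g -> a \in A -> k (g a) = k a).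

End root_systems.

Section dunkl_measure.
Context {R : realType} {d : nat}.
Variables (Ap : {fset 'rV[R]_d}) (k : 'rV[R]_d -> R).
Local Notation leb := (@lebesgue_rV R d).

Definition dunkl_weight (x : 'rV[R]_d) : R :=
  \prod_(a <- Ap) `|dot a x| `^ (2 * k a).

Definition dunkl_const : R :=
  (\int[leb]_x (expR (- (enorm x ^+ 2 / 2)) * dunkl_weight x))^-1.

Definition dunkl_lambda : R := d%:R / 2 - 1 + \sum_(a <- Ap) k a.

Definition dunkl_dim : R := 2 * dunkl_lambda + 2.

Lemma dunkl_weight_ge0 x : 0 <= dunkl_weight x.
Proof. by apply: prodr_ge0 => a _; exact: powR_ge0. Qed.

Lemma measurable_dunkl_weight : measurable_fun setT dunkl_weight.
Proof.
apply: measurable_prod => a _.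
apply: (measurableT_comp (measurable_powR (2 * k a))).
by apply: measurableT_comp => //; exact: measurable_dot.
Qed.

Lemma dunkl_const_ge0 : 0 <= dunkl_const.
Proof.
rewrite invr_ge0; apply: Rintegral_ge0 => x _.
by rewrite mulr_ge0 ?expR_ge0 ?dunkl_weight_ge0.
Qed.

Lemma dunkl_density_ge0 x : 0 <= dunkl_const * dunkl_weight x.
Proof. by rewrite mulr_ge0 ?dunkl_const_ge0 ?dunkl_weight_ge0. Qed.

Lemma measurable_dunkl_density :
  measurable_fun setT (fun x => dunkl_const * dunkl_weight x).
Proof. by apply: measurable_funM => //; exact: measurable_dunkl_weight. Qed.

Definition dunkl_measure : {measure set 'rV[R]_d -> \bar R} :=
  with_density leb dunkl_density_ge0 measurable_dunkl_density.

Lemma enorm_powR_ge0 (s : R) (x : 'rV[R]_d) : 0 <= enorm x `^ s.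
Proof. exact: powR_ge0. Qed.

Lemma measurable_enorm_powR (s : R) :
  measurable_fun setT (fun x : 'rV[R]_d => enorm x `^ s).
Proof. exact: (measurableT_comp (measurable_powR s) measurable_enorm). Qed.

(* For s < 0 the library sets 0 `^ s = 0, which only affects the origin, a
   null set. *)
Definition power_dunkl_measure (s : R) : {measure set 'rV[R]_d -> \bar R} :=
  with_density dunkl_measure (enorm_powR_ge0 s) (measurable_enorm_powR s).

End dunkl_measure.

Section schwartz.
Context {R : realType} {d : nat}.

Fixpoint iter_partial (s : seq 'I_d) (g : 'rV[R]_d -> R) : 'rV[R]_d -> R :=
  if s is i :: s' then fun x => 'D_(delta_mx ord0 i) (iter_partial s' g) x
  else g.

Definition smooth (g : 'rV[R]_d -> R) : Prop := forall s : seq 'I_d,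
  continuous (iter_partial s g) /\
  forall i x, derivable (iter_partial s g) x (delta_mx ord0 i).

Definition rapidly_decreasing (g : 'rV[R]_d -> R) : Prop :=
  forall (n : 'I_d -> nat) (s : seq 'I_d), exists C : R, forall x,
    `|monomial n x * iter_partial s g x| <= C.

(* Complex-valued Schwartz functions. Since x^n is real, the seminorms
   sup |x^n D^s f| are finite for f iff they are for Re f and Im f. *)
Definition schwartz : set ('rV[R]_d -> R[i]) := [set f |
  [/\ smooth (fun x => complex.Re (f x)),
      rapidly_decreasing (fun x => complex.Re (f x)),
      smooth (fun x => complex.Im (f x)) &
      rapidly_decreasing (fun x => complex.Im (f x))]].

End schwartz.

Section complex_Lp.
Context {disp : measure_display} {T : measurableType disp} {R : realType}.
Variable mu : {measure set T -> \bar R}.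

Definition complex_integral (f : T -> R[i]) : R[i] :=
  Complex (\int[mu]_x complex.Re (f x)) (\int[mu]_x complex.Im (f x)).

Definition complex_Lnorm (p : R) (f : T -> R[i]) : \bar R :=
  'N[mu]_p%:E[EFin \o (fun x => ComplexField.Normc.normc (f x))]%E.

Definition complex_Lp (p : R) : set (T -> R[i]) := [set f |
  [/\ measurable_fun setT (fun x => complex.Re (f x)),
      measurable_fun setT (fun x => complex.Im (f x)) &
      (complex_Lnorm p f < +oo)%E]].

(* Density for the Lp distance, on representatives of a.e. classes. *)
Definition dense_in_Lp (p : R) (E : set (T -> R[i])) : Prop :=
  E `<=` complex_Lp p /\
  forall f, complex_Lp p f -> forall e : R, 0 < e ->
    exists2 g, E g & (complex_Lnorm p (fun x => f x - g x)%R < e%:E)%E.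

End complex_Lp.

Definition Phi {R : realType} {d : nat} (Ap : {fset 'rV[R]_d})
    (k : 'rV[R]_d -> R) : set ('rV[R]_d -> R[i]) := [set f |
  schwartz f /\
  forall n : 'I_d -> nat,
    complex_integral (dunkl_measure Ap k)
      (fun x => Complex (monomial n x) 0 * f x) = 0].

Definition conj_exponent {R : realType} (p : R) : R := p / (p - 1).

(* Main.v *)
Require Import Defs.
From mathcomp Require Import all_boot all_order all_algebra.
From mathcomp Require Import finmap.
From mathcomp Require Import all_classical all_reals all_analysis.
From mathcomp Require Import measurable_realfun complex lra ring.
Set Implicit Arguments.
Unset Strict Implicit.
Unset Printing Implicit Defensive.
Import Order.TTheory GRing.Theory Num.Theory.
Import numFieldNormedType.Exports.
Local Open Scope classical_set_scope.
Local Open Scope ring_scope.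

(** Why the theorem is true.

Write D for the homogeneous dimension d_k and v for the weight. The measure
|x|^(beta p) v(x) dx is finite on cubes, so smooth functions with bounded support
are dense in the weighted Lp space (test_fun_dense). It is therefore enough to
find, for such a function phi, a Schwartz function h that has the same moments as
phi and an arbitrarily small norm: then phi - h is in Phi and close to phi. This
direct construction replaces any use of a Fourier-type transform or of duality.

The function h is a series h_0 + h_1 + ..., in the spirit of Borel's lemma: h_N
corrects the moments of total degree N and leaves those of lower degree alone. If
psi has vanishing moments below degree N, the dilate e^(D + N) psi(e x) has the
same moments of degree N as psi and still none below (moment_dilate). When psi is
supported in a cube away from the origin and e tends to 0, the dilate moves to
infinity, its Schwartz seminorms with weight and order at most N tend to 0, and so
does its supremum against (1 + |x|)^q as soon as q < D (corrector). The terms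
can thus be chosen so that the series is locally finite, converges in every
Schwartz seminorm, and is bounded by eta (1 + |x|)^(-q) with eta arbitrary
(schwartz_same_moments).

The hypotheses on beta say exactly that this is enough. The function
(1 + |x|)^(-q) belongs to the weighted Lp space when - D < beta p, which gives
integrability at the origin, and beta p + D < p q, which gives it at infinity
(integral_enorm_weight_lty); a number q with beta + D / p < q < D exists because
beta < D / p' = D - D / p.

It remains to find psi with prescribed moments up to degree N. Near the vector
that defines the positive subsystem there is a cube where v is positive and which
avoids the origin; without roots any nonzero vector will do (good_cube).
Polynomials times a bump function on that cube suffice: the corresponding linear
system has a Gram matrix, invertible because the monomials are linearly
independent on a cube (monomials_independent, moment_problem).

Moments are computed against v(x) dx, since the constant c_k is only a factor;
real and imaginary parts are treated separately. *)

(** * Densities and the Borel structure of row vectors *)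

Section measure_tools.
Context {disp : measure_display} {T : measurableType disp} {R : realType}.
Variables (mu : {measure set T -> \bar R}) (w : T -> R).
Hypotheses (w_ge0 : forall x, 0 <= w x) (mw : measurable_fun [set: T] w).
Local Notation nu := (with_density mu w_ge0 mw).
Local Open Scope ereal_scope.

Import HBNNSimple.

Let with_density_nnsfun (h : {nnsfun T >-> R}) :
  \int[nu]_x (h x)%:E = \int[mu]_x ((h x)%:E * (w x)%:E).
Proof.
under [LHS]eq_integral do rewrite fimfunE -fsumEFin//.
rewrite [LHS]ge0_integral_fsum//; last 2 first.
  - by move=> r; exact/measurable_EFinP/measurableT_comp.
  - by move=> n x _; rewrite EFinM nnfun_muleindic_ge0.
under [RHS]eq_integral.
  move=> x xD; rewrite fimfunE -fsumEFin// muleC ge0_mule_fsumr; last first.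
    by move=> r; rewrite EFinM nnfun_muleindic_ge0.
  over.
rewrite [RHS]ge0_integral_fsum//; last 2 first.
  - move=> r; apply: emeasurable_funM; first exact/measurable_EFinP.
    by apply/measurable_EFinP; do 2 apply/measurableT_comp => //.
  - by move=> n x _; rewrite EFinM mule_ge0 ?lee_fin// -lee_fin EFinM nnfun_muleindic_ge0.
apply: eq_fsbigr => r _; rewrite integralZl_indic_nnsfun//.
have mr : measurable (h @^-1` [set r]) by exact: measurable_funPTI.
rewrite integral_indic// setIT.
have [r0|r0] := ltP r 0%R.
  rewrite preimage_nnfun0// measure0 mule0; apply/esym/integral0_eq => x _.
  by rewrite indic0 mulr0 mule0.
under eq_integral => x _ do rewrite EFinM muleCA.
rewrite ge0_integralZl//; last 2 first.
  - by apply: emeasurable_funM; apply/measurable_EFinP.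
  - by move=> x _; rewrite mule_ge0// lee_fin.
congr (_ * _); rewrite [LHS]integral_mkcond; apply: eq_integral => x _.
by rewrite patchE indicE; case: (x \in _); rewrite ?mule1 ?mule0.
Qed.

Lemma ge0_integral_with_density (f : T -> \bar R) :
  measurable_fun setT f -> (forall x, 0 <= f x) ->
  \int[nu]_x f x = \int[mu]_x (f x * (w x)%:E).
Proof.
move=> mf f0; pose f_ := nnsfun_approx measurableT mf.
transitivity (limn (fun n => \int[nu]_x (f_ n x)%:E)).
  rewrite -monotone_convergence//=.
  - by apply: eq_integral => x _; apply/esym/cvg_lim => //; exact: cvg_nnsfun_approx.
  - by move=> n; exact/measurable_EFinP.
  - by move=> n x _; rewrite lee_fin.
  - by move=> x _ m n mn; rewrite lee_fin; exact/lefP/nd_nnsfun_approx.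
under eq_fun do rewrite with_density_nnsfun.
rewrite -monotone_convergence//=.
- apply: eq_integral => x _; apply/cvg_lim => //.
  apply: cvgeMr => //.
  exact: cvg_nnsfun_approx.
- by move=> n; apply: emeasurable_funM; exact/measurable_EFinP.
- by move=> n x _; rewrite mule_ge0// lee_fin.
- move=> x _ m n mn; rewrite lee_wpmul2r ?lee_fin//.
  exact/lefP/nd_nnsfun_approx.
Qed.

Lemma integral_with_density (f : T -> R) : measurable_fun setT f ->
  \int[nu]_x (f x)%:E = \int[mu]_x (f x * w x)%:E.
Proof.
move=> mf; have mf' : measurable_fun setT (EFin \o f) by exact/measurable_EFinP.
rewrite [LHS]integralE [RHS]integralE.
rewrite (ge0_integral_with_density (measurable_funepos mf'))//.
rewrite (ge0_integral_with_density (measurable_funeneg mf'))//.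
congr (_ - _); apply: eq_integral => x _.
- by rewrite !funeposE /= -!EFin_max -EFinM maxr_pMl// mul0r.
- by rewrite !funenegE /= -!EFin_max -EFinM maxr_pMl// mul0r mulNr.
Qed.

Lemma Rintegral_with_density (f : T -> R) : measurable_fun setT f ->
  Rintegral nu setT f = Rintegral mu setT (fun x => f x * w x)%R.
Proof. by move=> mf; rewrite /Rintegral integral_with_density. Qed.

End measure_tools.

Section lebesgue_rV_facts.
Context {R : realType} {d : nat}.
Local Notation E := 'rV[R]_d.
Local Notation leb := (@lebesgue_rV R d).

Lemma norm_coord_le (x : E) i : `|x ord0 i| <= `|x|.
Proof.
rewrite -[leRHS]/(mx_norm x) mx_normrE; apply/bigmax_geP; right => /=.
by exists (ord0, i).
Qed.

Lemma norm_rV_le (x : E) (r : R) : 0 <= r ->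
  (`|x| <= r) <-> (forall i, `|x ord0 i| <= r).
Proof.
move=> r0; split=> [xr i|xr]; first exact: le_trans (norm_coord_le x i) xr.
rewrite -[leLHS]/(mx_norm x) mx_normrE; apply/bigmax_leP; split => //= -[i j] _.
by rewrite ord1.
Qed.

Lemma norm_rV_lt (x : E) (r : R) : 0 < r ->
  (`|x| < r) <-> (forall i, `|x ord0 i| < r).
Proof.
move=> r0; split=> [xr i|xr]; first exact: le_lt_trans (norm_coord_le x i) xr.
rewrite -[ltLHS]/(mx_norm x) mx_normrE; apply/bigmax_ltP; split => //= -[i j] _.
by rewrite ord1.
Qed.

Lemma ball_rVP (x y : E) (r : R) : 0 < r ->
  ball x r y <-> (forall i, `|x ord0 i - y ord0 i| < r).
Proof.
move=> r0; have xy i : (x - y) ord0 i = x ord0 i - y ord0 i by rewrite !mxE.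
rewrite -ball_normE /=; split=> [h i|h]; first by rewrite -xy; move: i; apply/(norm_rV_lt _ r0).
by apply/(norm_rV_lt _ r0) => i; rewrite xy.
Qed.

Lemma measurable_box (A : 'I_d -> set R) : (forall i, measurable (A i)) ->
  measurable [set x : E | forall i, A i (x ord0 i)].
Proof.
move=> mA; rewrite [X in measurable X](_ : _ = \bigcap_(i in setT)
    ((fun x : E => x ord0 i) @^-1` A i)); last first.
  by apply/seteqP; split=> x /= xA i; [move=> _; exact: xA|exact: xA].
apply: fin_bigcap_measurable; first exact: finite_finset.
by move=> i _; rewrite -[X in measurable X]setTI; exact: measurable_coord.
Qed.

Lemma measurable_ball_rV (x : E) (r : R) : measurable (ball x r).
Proof.
have [r0|r0] := ltP 0 r; last first.
  rewrite [X in measurable X](_ : _ = set0); first exact: measurable0.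
  apply/seteqP; split=> // y; rewrite -ball_normE /= => xy.
  by have := le_lt_trans (normr_ge0 _) xy; rewrite ltNge r0.
suff -> : ball x r = [set y : E | forall i, ball (x ord0 i) r (y ord0 i)].
  by apply: (measurable_box (A := fun i => ball (x ord0 i) r)) => i; exact: measurable_ball.
by apply/seteqP; split => y /=; rewrite (ball_rVP _ _ r0) => xy i;
  have := xy i; rewrite -ball_normE.
Qed.

(** The sup norm makes balls into boxes, which are generated by the coordinates;
an open set is the countable union of the rational balls that it contains. *)
Lemma open_measurable_rV (U : set E) : open U -> measurable U.
Proof.
move=> oU.
pose P (q : {ffun 'I_d -> rat} * nat) : E := \row_i ratr (q.1 i).
pose r (q : {ffun 'I_d -> rat} * nat) : R := q.2.+1%:R^-1.
pose F q := [set y | ball (P q) (r q) y /\ ball (P q) (r q) `<=` U].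
have -> : U = \bigcup_q F q.
  apply/seteqP; split => x; last by move=> [q _ [qx qU]]; exact: qU.
  move=> Ux.
  have /nbhs_ballP[e /= e0 eU] : nbhs x U by exact: open_nbhs_nbhs.
  pose n := Num.trunc (2 / e).
  have n1e : n.+1%:R^-1 < e / 2.
    rewrite invf_plt ?posrE ?divr_gt0// invf_div.
    exact: truncnS_gt.
  have /choice[q qx] : forall i, exists q : rat, `|x ord0 i - ratr q| < n.+1%:R^-1.
    move=> i; have : x ord0 i - n.+1%:R^-1 < x ord0 i + n.+1%:R^-1.
      by rewrite ltrD2l gt0_cp.
    move=> /rat_in_itvoo[q]; rewrite in_itv /= => /andP[q1 q2]; exists q.
    by rewrite ltr_distlC q1 q2.
  exists ([ffun i => q i], n) => //; split.
    apply/ball_rVP => [|i]; first by rewrite /r invr_gt0.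
    by rewrite !mxE /= ffunE distrC.
  move=> y /ball_rVP Py; apply: eU; apply/ball_rVP => // i.
  have {Py} : `|ratr (q i) - y ord0 i| < n.+1%:R^-1.
    have := Py _ i; rewrite !mxE /= ffunE; apply.
    by rewrite /r invr_gt0.
  move=> qy; rewrite (splitr e); apply: le_lt_trans (ler_distD (ratr (q i)) _ _) _.
  by apply: ltrD; [exact: lt_trans (qx i) n1e|exact: lt_trans qy n1e].
apply: countable_bigcupT_measurable; first exact: countableP.
move=> q; have [qU|qU] := pselect (ball (P q) (r q) `<=` U).
  rewrite [X in measurable X](_ : _ = ball (P q) (r q)); first exact: measurable_ball_rV.
  by apply/seteqP; split => y; [case|move=> ?; split].
rewrite [X in measurable X](_ : _ = set0) //.
by apply/seteqP; split => y //; case.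
Qed.

Lemma continuous_measurable_rV (f : E -> R) :
  continuous f -> measurable_fun setT f.
Proof.
move=> /continuousP cf; apply: (measurability _ (RGenOpens.measurableE R)).
move=> _ [_ [a [b ->] <-]]; rewrite setTI; apply: open_measurable_rV.
exact/cf/interval_open.
Qed.

Lemma measurable_norm_rV : measurable_fun [set: E] (fun x => `|x|).
Proof. by apply: continuous_measurable_rV; exact: norm_continuous. Qed.

End lebesgue_rV_facts.

(** * Boxes, dilations and dyadic integrability *)

Section open_boxes.
Context {R : realType} {d : nat}.
Local Notation E := 'rV[R]_d.
Local Notation leb := (@lebesgue_rV R d).
Implicit Types a b : 'I_d -> R.

Definition open_box a b : set E := [set x | forall i, a i < x ord0 i < b i].

Definition open_boxes : set (set E) := [set A | exists a b, A = open_box a b].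

Lemma open_boxE a b :
  open_box a b = [set x | forall i, `]a i, b i[%classic (x ord0 i)].
Proof. by apply/seteqP; split => x /= + i => /(_ i); rewrite in_itv. Qed.

Lemma measurable_open_box a b : measurable (open_box a b).
Proof. by rewrite open_boxE; apply: (measurable_box (A := fun i => `]a i, b i[%classic)). Qed.

Lemma open_boxes_setI : setI_closed open_boxes.
Proof.
move=> _ _ [a [b ->]] [a' [b' ->]].
exists (fun i => Num.max (a i) (a' i)), (fun i => Num.min (b i) (b' i)).
apply/seteqP; split => x /=.
  move=> [h h'] i; rewrite gt_max lt_min.
  by move: (h i) (h' i) => /andP[-> ->] /andP[-> ->].
move=> h; split => i; move: (h i); rewrite gt_max lt_min.
  by move=> /andP[/andP[-> _] /andP[-> _]].
by move=> /andP[/andP[_ ->] /andP[_ ->]].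
Qed.

Definition cube (n : nat) : set E := open_box (fun=> - n%:R) (fun=> n%:R).

Lemma cube_cover : \bigcup_n cube n = setT.
Proof.
apply/seteqP; split => // x _; exists (Num.trunc `|x|).+1 => //= i.
rewrite -ltr_norml; apply: le_lt_trans (norm_coord_le x i) _.
exact: truncnS_gt.
Qed.

(** Open boxes form a pi-system, so that uniqueness of measures and the
approximation of indicator functions only have to be checked on them. *)
Lemma measurable_rVE : @measurable _ E = <<s open_boxes >>.
Proof.
apply/seteqP; split; last first.
  apply: smallest_sub; first exact: sigma_algebra_measurable.
  by move=> _ [a [b ->]]; exact: measurable_open_box.
apply: smallest_sub; first exact: smallest_sigma_algebra.
rewrite -bigcup_seq => _ [i _] [B mB <-]; rewrite setTI.
pose H : set (set R) := [set B | <<s open_boxes >> ((fun x : E => x ord0 i) @^-1` B)].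
suff HG : <<s @RGenOpens.G R >> `<=` H.
  apply: HG; suff : (@RGenOpens.G R).-sigma.-measurable B by [].
  by rewrite -(RGenOpens.measurableE R).
apply: smallest_sub.
  split.
  - by rewrite /H /= preimage_set0; exact: sigma_algebra0.
  - by move=> A HA; rewrite /H /= setTD -preimage_setC; exact: sigma_algebraC.
  - by move=> F HF; rewrite /H /= preimage_bigcup; exact: sigma_algebra_bigcup.
move=> _ [a [b ->]]; rewrite /H /=.
have -> : (fun x : E => x ord0 i) @^-1` `]a, b[%classic = \bigcup_n
    open_box (fun j => if j == i then a else - n%:R)
             (fun j => if j == i then b else n%:R).
  apply/seteqP; split => x /=.
    rewrite in_itv /= => xab; have [n _ xn] : (\bigcup_n cube n) x by rewrite cube_cover.
    by exists n => //= j; case: eqP => [->//|_]; exact: xn.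
  by move=> [n _] /(_ i); rewrite eqxx in_itv.
apply: sigma_algebra_bigcup => n; apply: sub_sigma_algebra.
by eexists; eexists; reflexivity.
Qed.

Lemma lebesgue_open_box a b : (forall i, a i <= b i) ->
  leb (open_box a b) = (\prod_(i < d) (b i - a i))%:E.
Proof.
move=> ab; rewrite open_boxE.
rewrite (lebesgue_rV_box (A := fun i => `]a i, b i[%classic))//.
elim/big_ind2 : _ => // [_ y _ y' -> -> //|i _].
rewrite lebesgue_measure_itv /= lte_fin.
have [//|ba] := ltP (a i) (b i).
have -> : a i = b i by apply/eqP; rewrite eq_le ab ba.
by rewrite subrr.
Qed.

Lemma lebesgue_ball_le (r : R) : 0 <= r ->
  (leb [set x : E | (`|x| <= r)%R] <= ((2 * r) ^+ d)%:E)%E.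
Proof.
move=> r0; rewrite (_ : mkset _ =
    [set x : E | forall i, (fun=> `[-r, r]%classic) i (x ord0 i)]).
  rewrite (lebesgue_rV_box (A := fun=> `[-r, r]%classic))//.
  rewrite big_const card_ord lebesgue_measure_itv /= lte_fin.
  have [rr|rr] := ltP (- r) r.
    rewrite -EFinB opprK -mulr2n mulr_natl.
    by elim: (d) => [//|n ih] /=; rewrite exprS EFinM lee_wpmul2l// lee_fin mulrn_wge0.
  have -> : r = 0 by lra.
  rewrite mulr0.
  by elim: (d) => [//|n ih] /=; rewrite mul0e lee_fin exprn_ge0.
apply/seteqP; split => x /=.
  by move/(norm_rV_le _ r0) => + i => /(_ i); rewrite in_itv/= ler_norml.
move=> h; apply/(norm_rV_le _ r0) => i; move: (h i).
by rewrite in_itv/= ler_norml.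
Qed.

Lemma measurable_scale (e : R) : measurable_fun setT (fun x : E => e *: x).
Proof.
apply/measurable_fun_coordP => i; under eq_fun do rewrite mxE.
by apply: measurable_funM => //; exact: measurable_coord.
Qed.

(** Both sides are measures in A that agree on open boxes, where the volume is
an explicit product. *)
Lemma lebesgue_scale (e : R) (A : set E) : 0 < e -> measurable A ->
  leb ((fun x => e *: x) @^-1` A) = ((e ^+ d)^-1%:E * leb A)%E.
Proof.
move=> e0 mA.
have ed0 : 0 <= (e ^+ d)^-1 by rewrite invr_ge0 exprn_ge0// ltW.
pose m1 : {measure set E -> \bar R} :=
  measure_function_pushforward__canonical__measure_function_Measure leb
    (measurable_scale e).
rewrite -[LHS]/(m1 A) -[RHS]/(mscale (NngNum ed0) leb A).
apply: (measure_unique open_boxes cube) => //.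
- exact: measurable_rVE.
- exact: open_boxes_setI.
- by move=> n; eexists; eexists; reflexivity.
- exact: cube_cover.
- have scaleE a b : (fun x : E => e *: x) @^-1` open_box a b =
      open_box (fun i => e^-1 * a i) (fun i => e^-1 * b i).
    apply/seteqP; split => x /= + i => /(_ i);
    by rewrite mxE ltr_pdivrMl// ltr_pdivlMl.
  move=> _ [a [b ->]]; rewrite /m1 /= /mscale /pushforward /= scaleE.
  have [ab|/existsNP[i /negP abi]] := pselect (forall i, a i <= b i).
    rewrite !lebesgue_open_box//; last by move=> i; rewrite ler_pM2l ?invr_gt0.
    rewrite -EFinM; congr EFin.
    under eq_bigr do rewrite -mulrBr.
    by rewrite big_split /= prodr_const card_ord exprVn.
  have nil c : 0 < c -> open_box (fun i => c * a i) (fun i => c * b i) = set0.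
    move=> c0; apply/seteqP; split => // x /(_ i) /andP[h1 h2].
    by have := lt_trans h1 h2; rewrite ltr_pM2l// ltNge (ltW _)// ltNge.
  rewrite nil ?invr_gt0// measure0.
  have -> : open_box a b = set0.
    by rewrite -(nil 1 ltr01); congr open_box; apply/funext => j; rewrite mul1r.
  by rewrite measure0 mule0.
- move=> n; rewrite /m1 /= /pushforward.
  rewrite (_ : _ @^-1` _ = open_box (fun i => e^-1 * - n%:R) (fun i => e^-1 * n%:R)).
    rewrite lebesgue_open_box ?ltry// => _; rewrite ler_pM2l ?invr_gt0//.
    by rewrite (@le_trans _ _ 0)// oppr_le0.
  apply/seteqP; split => x /= + i => /(_ i);
  by rewrite mxE ltr_pdivrMl// ltr_pdivlMl.
Qed.

Lemma ge0_integral_scale (e : R) (f : E -> \bar R) : 0 < e ->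
  measurable_fun setT f -> (forall x, (0 <= f x)%E) ->
  (\int[leb]_x f (e *: x)%R = (e ^+ d)^-1%:E * \int[leb]_x f x)%E.
Proof.
move=> e0 mf f0; have ed0 : 0 <= (e ^+ d)^-1 by rewrite invr_ge0 exprn_ge0// ltW.
rewrite -(@ge0_integral_mscale _ _ _ leb setT measurableT (NngNum ed0))//.
have := @ge0_integral_pushforward _ _ _ _ _ _ (measurable_scale e) leb setT f
  measurableT mf (fun x _ => f0 x).
rewrite preimage_setT => <-.
apply: eq_measure_integral; first exact: measurable_scale.
by move=> ? A mA _; exact: (lebesgue_scale e0 mA).
Qed.

(* Extended subtraction has +oo - +oo = -oo, and a positive real factor
preserves this convention; hence the change of variables below needs no
integrability. *)
Let muleBr_pos (c : R) (x y : \bar R) : 0 < c ->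
  (c%:E * x - c%:E * y = c%:E * (x - y))%E.
Proof.
move=> c0; have sc : ((Num.sg c)%:E = 1)%E by rewrite gtr0_sg.
have mo : (c%:E * +oo = +oo)%E by rewrite mulry sc mul1e.
have NN : (- (-oo) = +oo :> \bar R)%E by [].
have mn : (c%:E * -oo = -oo)%E by rewrite mulrNy sc mul1e.
case: x => [u||]; case: y => [v||]; last 8 first.
- by rewrite mo -EFinM /= mn.
- by rewrite mn -EFinM NN !addey// mo.
- by rewrite mo -EFinM -!EFinN !addye// mo.
- by rewrite mo; exact: esym mn.
- by rewrite mo mn NN !addey// mo.
- by rewrite mn -EFinM -!EFinN !addNye.
- by rewrite mo mn ?addNye ?mn.
- by rewrite mn NN ?addNye ?mn.
by rewrite -!EFinM -EFinB mulrBr.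
Qed.

Lemma integral_scale (e : R) (f : E -> R) : 0 < e -> measurable_fun setT f ->
  (\int[leb]_x (f (e *: x)%R)%:E = (e ^+ d)^-1%:E * \int[leb]_x (f x)%:E)%E.
Proof.
move=> e0 mf; have mf' : measurable_fun setT (EFin \o f) by exact/measurable_EFinP.
have ed0 : 0 < (e ^+ d)^-1 by rewrite invr_gt0 exprn_gt0.
rewrite [LHS]integralE [X in (_ * X)%E]integralE.
have pE : (fun x => (f (e *: x))%:E)^\+%E = (fun x => (EFin \o f)^\+%E (e *: x)).
  by apply/funext => x; rewrite !funeposE.
have nE : (fun x => (f (e *: x))%:E)^\-%E = (fun x => (EFin \o f)^\-%E (e *: x)).
  by apply/funext => x; rewrite !funenegE.
rewrite pE nE (ge0_integral_scale e0 (measurable_funepos mf'))//.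
rewrite (ge0_integral_scale e0 (measurable_funeneg mf'))//.
exact: muleBr_pos.
Qed.

Lemma Rintegral_scale (e : R) (f : E -> R) : 0 < e -> measurable_fun setT f ->
  \int[leb]_x f (e *: x) = (e ^+ d)^-1 * \int[leb]_x f x.
Proof.
move=> e0 mf; rewrite /Rintegral integral_scale//.
have sc : ((Num.sg (e ^+ d)^-1)%:E = 1%:E :> \bar R)%E.
  by rewrite gtr0_sg// invr_gt0 exprn_gt0.
set I := (\int[leb]_x (f x)%:E)%E; case: I => [u//||].
  by rewrite mulry sc mul1e mulr0.
by rewrite mulrNy sc mul1e mulr0.
Qed.

(** The balls of radius r^n have volume (2r^n)^d, so a function that is at most
C z^n somewhere on a scale r^n is dominated by a geometric series. *)
Lemma integral_dyadic_lty (f : E -> R) (C z r : R) :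
  measurable_fun setT f -> (forall x, 0 <= f x) ->
  0 <= C -> 0 < z -> 0 < r -> z * r ^+ d < 1 ->
  (forall x, f x != 0 -> exists n, f x <= C * z ^+ n /\ `|x| <= r ^+ n) ->
  (\int[leb]_x (f x)%:E < +oo)%E.
Proof.
move=> mf f0 C0 z0 r0 zr fC.
have mb s : measurable [set x : E | `|x| <= s].
  rewrite -[X in measurable X]setTI.
  exact: (measurable_norm_rV measurableT (measurable_itv `]-oo, s])).
pose g n (x : E) : \bar R := ((C * z ^+ n)%:E * (\1_[set x : E | `|x| <= r ^+ n] x)%:E)%E.
have g0 n x : (0 <= g n x)%E.
  by rewrite mule_ge0// lee_fin// mulr_ge0// exprn_ge0// ltW.
have mg n : measurable_fun setT (g n).
  by apply: measurable_funeM; exact/measurable_EFinP.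
have fg x : ((f x)%:E <= \sum_(n <oo) g n x)%E.
  have [->|/fC[n [fn xn]]] := eqVneq (f x) 0.
    by apply: nneseries_ge0 => n _ _; exact: g0.
  apply: (le_trans _ (nneseries_lim_ge n.+1 (fun m _ _ => g0 m x))).
  rewrite big_nat_recr//= -[leLHS]add0e; apply: leeD.
    by apply: sume_ge0 => m _; exact: g0.
  by rewrite /g indicE mem_set// mule1 lee_fin.
apply: (@le_lt_trans _ _ (\int[leb]_x \sum_(n <oo) g n x)%E).
  apply: ge0_le_integral.
  - exact: measurableT.
  - by move=> x _; rewrite lee_fin.
  - exact/measurable_EFinP.
  - by apply: ge0_emeasurable_sum => [n x _ _|n _]; [exact: g0|exact: mg].
  - by move=> x _; exact: fg.
rewrite integral_nneseries//.
have zr0 : 0 < z * r ^+ d by rewrite mulr_gt0// exprn_gt0.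
apply: (@le_lt_trans _ _ (C * 2 ^+ d * (1 - z * r ^+ d)^-1)%:E); last exact: ltry.
apply: lime_le; first by apply: is_cvg_nneseries => n _ _; exact: integral_ge0.
apply: nearW => n.
apply: (@le_trans _ _ (\sum_(0 <= k < n) (C * 2 ^+ d * (z * r ^+ d) ^+ k)%:E)%E).
  apply: lee_sum => k _.
  rewrite ge0_integralZl//; last 2 first.
    exact/measurable_EFinP.
    by rewrite lee_fin mulr_ge0// exprn_ge0// ltW.
  rewrite integral_indic// setIT.
  apply: (@le_trans _ _ ((C * z ^+ k)%:E * ((2 * r ^+ k) ^+ d)%:E)%E).
    apply: lee_wpmul2l; first by rewrite lee_fin mulr_ge0// exprn_ge0// ltW.
    by apply: lebesgue_ball_le; rewrite exprn_ge0// ltW.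
  by rewrite -EFinM lee_fin !exprMn -!exprM (mulnC k); lra.
rewrite sumEFin lee_fin.
apply: (le_trans _ (@geometric_le_lim _ n _ _ _ zr0 _)) => //.
  by rewrite mulr_ge0// exprn_ge0.
by rewrite gtr0_norm.
Qed.

End open_boxes.

(** * Integrability of powers of the norm *)

Section power_integrability.
Context {R : realType} {d : nat}.
Local Notation E := 'rV[R]_d.
Local Notation leb := (@lebesgue_rV R d).

Lemma dyadic_scale (y : R) : 1 <= y -> exists n, 2 ^+ n <= y < 2 ^+ n.+1.
Proof.
move=> y1.
have ex : exists n, y < 2 ^+ n.+1.
  exists (Num.trunc y); apply: lt_trans (truncnS_gt y) _.
  by rewrite -natrX ltr_nat; exact: ltn_expl.
case: (ex_minnP ex) => [[|n]] yn nmin; first by exists 0%N; rewrite expr0 y1.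
exists n.+1; rewrite yn andbT leNgt; apply/negP => /nmin.
by rewrite ltnn.
Qed.

Lemma powRXn (x s : R) n : 0 <= x -> (x ^+ n) `^ s = (x `^ s) ^+ n.
Proof. by move=> x0; rewrite -powR_mulrn// -powRrM mulrC powRrM powR_mulrn// powR_ge0. Qed.

Lemma gt0_powR_le (x y s : R) : 0 < x -> x <= y -> s <= 0 -> y `^ s <= x `^ s.
Proof.
move=> x0 xy s0; rewrite -[s]opprK !(powRN _ (- s)) lef_pV2 ?posrE ?powR_gt0//.
  by apply: ge0_ler_powR; rewrite ?nnegrE ?oppr_ge0// ltW// (lt_le_trans x0).
exact: lt_le_trans xy.
Qed.

Let measurable_norm_powR s : measurable_fun [set: E] (fun x => `|x| `^ s).
Proof. exact: (measurableT_comp (measurable_powR s) measurable_norm_rV). Qed.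

Let indic_norm (s : R) (b : bool) : measurable [set x : E | (`|x| <= s) == b].
Proof.
rewrite -[X in measurable X]setTI.
case: b.
  rewrite (_ : mkset _ = (fun x : E => `|x|) @^-1` `]-oo, s]%classic).
    exact: (measurable_norm_rV measurableT (measurable_itv `]-oo, s])).
  by apply/seteqP; split => x /=; rewrite in_itv /=; case: (_ <= _).
rewrite (_ : mkset _ = (fun x : E => `|x|) @^-1` `]s, +oo[%classic).
  exact: (measurable_norm_rV measurableT (measurable_itv `]s, +oo[)).
by apply/seteqP; split => x /=; rewrite in_itv /= andbT ltNge; case: (_ <= _).
Qed.

Lemma two_powR_lt1 (s : R) : 0 < s -> 2 `^ (- s) < 1 :> R.
Proof.
move=> s0; rewrite powRN invf_lt1 ?powR_gt0//.
by rewrite /powR gt_eqF// expR_gt1 mulr_gt0// ln_gt0// ltr1n.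
Qed.

(** Near the origin, |x|^s is comparable to (2^-s)^n on the annulus of radius
2^-n, whose volume is of order 2^-nd; at infinity the annulus of radius 2^n
carries values of order 2^n(s - t). The two conditions on s and t are the
convergence of the two geometric series. *)
Lemma integral_norm_powR_lty (s t : R) : - d%:R < s -> s + d%:R < t ->
  (\int[leb]_x (`|x| `^ s * (1 + `|x|) `^ (- t))%:E < +oo)%E.
Proof.
move=> ds st.
(* f1 carries the singularity at the origin and f2 the tail *)
pose f1 (x : E) := `|x| `^ s * \1_[set x : E | (`|x| <= 1) == true] x.
pose f2 (x : E) := `|x| `^ (s - t) * \1_[set x : E | (`|x| <= 1) == false] x.
have f10 x : 0 <= f1 x by rewrite mulr_ge0// powR_ge0.
have f20 x : 0 <= f2 x by rewrite mulr_ge0// powR_ge0.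
have mf1 : measurable_fun setT f1.
  by apply: measurable_funM => //; exact/measurable_indic/indic_norm.
have mf2 : measurable_fun setT f2.
  by apply: measurable_funM => //; exact/measurable_indic/indic_norm.
have t0 : 0 < t by apply: le_lt_trans st; lra.
have expz u : 2 `^ (- (u + d%:R)) = 2 `^ (- u) * 2^-1 ^+ d :> R.
  rewrite -powR_inv1// -powR_mulrn ?powR_ge0// -powRrM -powRD.
    by congr powR; lra.
  by rewrite pnatr_eq0 implybT.
have fin1 : (\int[leb]_x (f1 x)%:E < +oo)%E.
  apply: (@integral_dyadic_lty _ _ f1 (Num.max 1 (2 `^ (- s))) (2 `^ (- s)) 2^-1) => //.
  - by rewrite -expz two_powR_lt1//; lra.
  move=> x; rewrite /f1 indicE.
  case: (boolP (x \in _)) => [|_]; last by rewrite mulr0 eqxx.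
  rewrite inE /= => /eqP x1; rewrite mulr1 => _.
  have [->|x0] := eqVneq x 0.
    exists 0%N; rewrite normr0 !expr0 mulr1 ler01; split=> //.
    by rewrite le_max /powR eqxx lern1 leq_b1.
  have y0 : 0 < `|x| by rewrite normr_gt0.
  have /dyadic_scale[n /andP[nx xn]] : 1 <= `|x|^-1 by rewrite invr_ge1// unitf_gt0.
  have xn1 : `|x| <= 2^-1 ^+ n.
    by rewrite exprVn -[leLHS]invrK lef_pV2 ?posrE ?exprn_gt0 ?invr_gt0.
  have xn2 : 2^-1 ^+ n.+1 <= `|x|.
    by rewrite exprVn -[leRHS]invrK lef_pV2 ?posrE ?exprn_gt0 ?invr_gt0// ltW.
  exists n; split => //.
  have e2 : 2 `^ (- s) = 2^-1 `^ s :> R by rewrite -[2^-1]powR_inv1// -powRrM mulN1r.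
  have [s0|s0] := leP 0 s.
    apply: (@le_trans _ _ ((2 `^ (- s)) ^+ n)); last first.
      by apply: ler_peMl; [exact/exprn_ge0/powR_ge0|rewrite le_max lexx].
    by rewrite e2 -powRXn//; apply: ge0_ler_powR; rewrite ?nnegrE ?exprn_ge0.
  apply: (@le_trans _ _ ((2 `^ (- s)) ^+ n.+1)).
    by rewrite e2 -powRXn//; apply: gt0_powR_le => //; exact: ltW.
  by rewrite exprS; apply: ler_wpM2r; [exact/exprn_ge0/powR_ge0|rewrite le_max lexx orbT].
have fin2 : (\int[leb]_x (f2 x)%:E < +oo)%E.
  apply: (@integral_dyadic_lty _ _ f2 (2 `^ (t - s)) (2 `^ (s - t)) 2) => //.
  - have : 2 `^ (s - t + d%:R) < 1 :> R.
      by rewrite -[_ + _]opprK two_powR_lt1//; lra.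
    by rewrite powRD ?powR_mulrn// pnatr_eq0 implybT.
  move=> x; rewrite /f2 indicE.
  case: (boolP (x \in _)) => [|_]; last by rewrite mulr0 eqxx.
  rewrite inE /= => /eqP/negbT; rewrite -ltNge => x1; rewrite mulr1 => _.
  have /dyadic_scale[n /andP[nx xn]] := ltW x1.
  exists n.+1; split; last exact: ltW.
  rewrite exprS mulrA -powRD; last by rewrite pnatr_eq0 implybT.
  rewrite (_ : t - s + (s - t) = 0) ?powRr0 ?mul1r; last by lra.
  rewrite -powRXn//; apply: gt0_powR_le => //.
  by rewrite subr_le0; apply: le_trans (ltW st); rewrite lerDl.
apply: (@le_lt_trans _ _ (\int[leb]_x ((f1 x)%:E + (f2 x)%:E))%E); last first.
  rewrite ge0_integralD//; first exact: lte_add_pinfty.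
  - by move=> x _; rewrite lee_fin.
  - exact/measurable_EFinP.
  - by move=> x _; rewrite lee_fin.
  - exact/measurable_EFinP.
apply: ge0_le_integral.
- exact: measurableT.
- by move=> x _; rewrite lee_fin mulr_ge0 ?powR_ge0.
- apply/measurable_EFinP; apply: measurable_funM => //.
  apply: (measurableT_comp (measurable_powR (- t))).
  by apply: measurable_funD => //; exact: measurable_norm_rV.
- by apply: emeasurable_funD; exact/measurable_EFinP.
move=> x _; rewrite -EFinD lee_fin /f1 /f2 !indicE.
have pt : (1 + `|x|) `^ (- t) <= 1.
  have p1 : 1 `^ (- t) = 1 :> R by rewrite powR1.
  rewrite -[leRHS]p1; apply: gt0_powR_le => //; first by rewrite lerDl.
  by rewrite oppr_le0 ltW.
have [x1|x1] := leP `|x| 1.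
  have -> : (x \in [set x : E | (`|x| <= 1) == true]) = true by apply: mem_set; rewrite /= x1.
  have -> : (x \in [set x : E | (`|x| <= 1) == false]) = false.
    by apply: memNset; rewrite /= x1.
  by rewrite mulr1 mulr0 addr0 ler_piMr ?powR_ge0.
have -> : (x \in [set x : E | (`|x| <= 1) == true]) = false.
  by apply: memNset; rewrite /= leNgt x1.
have -> : (x \in [set x : E | (`|x| <= 1) == false]) = true.
  by apply: mem_set; rewrite /= leNgt x1.
rewrite mulr0 add0r mulr1 powRD; last first.
  by rewrite normr_eq0 -normr_gt0 (lt_trans _ x1)// implybT.
rewrite ler_wpM2l ?powR_ge0//; apply: gt0_powR_le; first exact: lt_trans x1.
  by rewrite lerDr.
by rewrite oppr_le0 ltW.
Qed.

End power_integrability.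

(** * The Dunkl weight *)

Section dunkl_weight_bounds.
Context {R : realType} {d : nat}.
Local Notation E := 'rV[R]_d.
Local Notation leb := (@lebesgue_rV R d).

Lemma dot_le (a x : E) : `|dot a x| <= (\sum_i `|a ord0 i|) * `|x|.
Proof.
rewrite mulr_suml; apply: le_trans (ler_norm_sum _ _ _) _.
by apply: ler_sum => i _; rewrite normrM ler_wpM2l// norm_coord_le.
Qed.

Lemma dotZr (a x : E) (e : R) : dot a (e *: x) = e * dot a x.
Proof. by rewrite /dot mulr_sumr; apply: eq_bigr => i _; rewrite mxE mulrCA. Qed.

Lemma norm_le_enorm (x : E) : `|x| <= enorm x.
Proof.
apply/norm_rV_le => [|i]; first exact: sqrtr_ge0.
rewrite -sqrtr_sqr /enorm; apply: ler_wsqrtr.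
rewrite /dot (bigD1 i)//= -expr2 lerDl; apply: sumr_ge0 => j _.
by rewrite -expr2 sqr_ge0.
Qed.

Lemma enorm_le_norm (x : E) : enorm x <= Num.sqrt d%:R * `|x|.
Proof.
rewrite -[X in _ * X]ger0_norm// -sqrtr_sqr -sqrtrM ?ler0n//; apply: ler_wsqrtr.
rewrite /dot mulr_natl -[X in _ *+ X]card_ord -sumr_const; apply: ler_sum => i _.
by rewrite -expr2 -real_normK ?num_real// lerXn2r ?nnegrE// norm_coord_le.
Qed.

Lemma enorm_powR_le (s : R) : exists2 C, 0 <= C &
  forall x : E, enorm x `^ s <= C * `|x| `^ s.
Proof.
have [s0|s0] := leP 0 s.
  exists (Num.sqrt d%:R `^ s) => [|x]; first exact: powR_ge0.
  rewrite -powRM ?sqrtr_ge0//; apply: ge0_ler_powR => //.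
  - by rewrite nnegrE sqrtr_ge0.
  - by rewrite nnegrE mulr_ge0 ?sqrtr_ge0.
  - exact: enorm_le_norm.
exists 1 => // x; rewrite mul1r.
have [->|x0] := eqVneq x 0.
  rewrite normr0 (_ : enorm 0 = 0)//.
  by rewrite /enorm /dot big1 ?sqrtr0// => i _; rewrite mxE mulr0.
by apply: gt0_powR_le; rewrite ?normr_gt0 ?norm_le_enorm// ltW.
Qed.

(** Nonnegativity of the exponents is what makes the rule true at x = 0, where
a power is 1 or 0 according to whether the exponent vanishes. *)
Lemma powR_sum_nneg (I : eqType) (r : seq I) (f : I -> R) (x : R) : 0 <= x ->
  (forall i, i \in r -> 0 <= f i) ->
  \prod_(i <- r) x `^ f i = x `^ (\sum_(i <- r) f i).
Proof.
move=> x0; elim: r => [|i r ih] f0; first by rewrite !big_nil powRr0.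
rewrite !big_cons ih; last by move=> j jr; apply: f0; rewrite inE jr orbT.
have fi : 0 <= f i by apply: f0; rewrite mem_head.
have fr : 0 <= \sum_(j <- r) f j.
  by rewrite big_seq sumr_ge0// => j jr; apply: f0; rewrite inE jr orbT.
have [->|xn0] := eqVneq x 0; last by rewrite powRD ?xn0 ?implybT.
rewrite /powR eqxx -natrM mulnb paddr_eq0//.
Qed.

Variables (Ap : {fset E}) (k : E -> R).
Hypothesis k0 : forall a, a \in Ap -> 0 <= k a.
Local Notation v := (dunkl_weight Ap k).

(** The weight is positively homogeneous of this degree. *)
Definition weight_degree : R := \sum_(a <- Ap) 2 * k a.

Lemma weight_degree_ge0 : 0 <= weight_degree.
Proof. by rewrite /weight_degree big_seq sumr_ge0// => a /k0 ?; rewrite mulr_ge0. Qed.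

Lemma dunkl_dimE : dunkl_dim Ap k = d%:R + weight_degree.
Proof. by rewrite /dunkl_dim /dunkl_lambda /weight_degree -mulr_sumr; lra. Qed.

Lemma dunkl_weightZ (e : R) (x : E) : 0 < e -> v (e *: x) = e `^ weight_degree * v x.
Proof.
move=> e0; rewrite /weight_degree -powR_sum_nneg ?(ltW e0)//; last first.
  by move=> a /k0 ?; rewrite mulr_ge0.
rewrite -big_split /=; apply: eq_bigr => a _.
by rewrite dotZr normrM powRM// gtr0_norm.
Qed.

Lemma dunkl_weight_le : exists2 C, 0 <= C & forall x : E, v x <= C * `|x| `^ weight_degree.
Proof.
exists (\prod_(a <- Ap) (\sum_i `|a ord0 i|) `^ (2 * k a)) => [|x].
  by apply: prodr_ge0 => a _; exact: powR_ge0.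
rewrite /weight_degree -powR_sum_nneg//; last by move=> a /k0 ?; rewrite mulr_ge0.
rewrite -big_split /= /dunkl_weight big_seq [leRHS]big_seq.
apply: ler_prod => a aA; rewrite powR_ge0/= -powRM ?sumr_ge0//.
apply: ge0_ler_powR; rewrite ?nnegrE ?mulr_ge0 ?sumr_ge0 ?k0 ?dot_le//.
Qed.

(** The weight is at most a multiple of |x|^weight_degree, so this is the
integrability of a power of the norm with exponent s + weight_degree. *)
Lemma integral_enorm_weight_lty (s t : R) :
  - dunkl_dim Ap k < s -> s + dunkl_dim Ap k < t ->
  (\int[leb]_x (enorm x `^ s * v x * (1 + `|x|) `^ (- t))%:E < +oo)%E.
Proof.
rewrite dunkl_dimE => ds st.
have [C1 C10 hC1] := enorm_powR_le s; have [C2 C20 hC2] := dunkl_weight_le.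
have mpow s' : measurable_fun [set: E] (fun x => `|x| `^ s').
  exact: (measurableT_comp (measurable_powR s') measurable_norm_rV).
have mt : measurable_fun [set: E] (fun x => (1 + `|x|) `^ (- t)).
  apply: (measurableT_comp (measurable_powR (- t))).
  by apply: measurable_funD => //; exact: measurable_norm_rV.
(* the constant is 1 + C1 rather than C1 because of the origin, where the
  power of the norm is 1 when s = 0 *)
apply: (@le_lt_trans _ _ (\int[leb]_x
   (((1 + C1) * C2)%:E * (`|x| `^ (s + weight_degree) * (1 + `|x|) `^ (- t))%:E))%E).
  apply: ge0_le_integral.
  - exact: measurableT.
  - by move=> x _; rewrite lee_fin !mulr_ge0 ?powR_ge0 ?dunkl_weight_ge0.
  - apply/measurable_EFinP; apply: measurable_funM => //; apply: measurable_funM.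
      exact: measurable_enorm_powR.
    exact: measurable_dunkl_weight.
  - by apply: measurable_funeM; apply/measurable_EFinP; exact: measurable_funM.
  move=> x _; rewrite -EFinM lee_fin mulrA ler_wpM2r ?powR_ge0//.
  have [x0|x0] := eqVneq x 0; last first.
    rewrite powRD ?normr_eq0 ?x0 ?implybT// mulrACA.
    apply: ler_pM; rewrite ?powR_ge0 ?dunkl_weight_ge0//.
    by apply: le_trans (hC1 x) _; rewrite ler_wpM2r ?powR_ge0// lerDr.
  have [->|s0] := eqVneq s 0.
    rewrite powRr0 mul1r add0r; apply: le_trans (hC2 x) _.
    by rewrite ler_wpM2r ?powR_ge0// ler_peMl// lerDl.
  have -> : enorm x `^ s = 0.
    apply/eqP; rewrite powR_eq0 s0 andbT; apply/eqP.
    by rewrite x0 /enorm /dot big1 ?sqrtr0// => i _; rewrite mxE mulr0.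
  by rewrite mul0r !mulr_ge0 ?powR_ge0// addr_ge0.
rewrite ge0_integralZl//.
- rewrite lte_mul_pinfty// ?lee_fin ?mulr_ge0 ?addr_ge0//.
  by apply: integral_norm_powR_lty; lra.
- by apply/measurable_EFinP; exact: measurable_funM.
- by rewrite lee_fin mulr_ge0// addr_ge0.
Qed.

End dunkl_weight_bounds.

(** * Smooth functions of one variable *)

Section smooth_line.
Context {R : realType}.
Implicit Types f g : R -> R.

(** Each derivative is only asserted to exist, so that the closure properties
need no formula for iterated derivatives. *)
Fixpoint diffn n f : Prop :=
  if n is m.+1 then
    exists2 g, (forall x, is_derive x (1 : R) f (g x)) & diffn m g
  else True.

Definition smooth1 f := forall n, diffn n f.

Lemma diffnS n f : diffn n.+1 f -> diffn n f.
Proof. by elim: n f => [//|n ih] f [g df /ih dg]; exists g. Qed.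

Lemma smooth1_derive f : smooth1 f ->
  (forall x, is_derive x (1 : R) f (derive1 f x)) /\ smooth1 (derive1 f).
Proof.
move=> sf; have fE g : (forall x, is_derive x (1 : R) f (g x)) -> (derive1 f) = g.
  by move=> dg; apply/funext => x; rewrite derive1E derive_val.
split=> [x|n]; first by have [g dg _] := sf 1%N; rewrite (fE g).
by have [g dg ng] := sf n.+1; rewrite (fE g).
Qed.

Lemma smooth1_continuous f : smooth1 f -> continuous f.
Proof.
move=> /smooth1_derive[df _] x; apply/differentiable_continuous.
by apply/derivable1_diffP; exact: ex_derive.
Qed.

Lemma diffn_eq n f g : f =1 g -> diffn n f -> diffn n g.
Proof. by move=> /funext ->. Qed.

Lemma diffn_cst n (c : R) : diffn n (cst c).
Proof. by elim: n c => [//|n ih] c; exists (cst 0) => [x|]; [exact: is_derive_cst|exact: ih]. Qed.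

Lemma diffn_add n f g : diffn n f -> diffn n g -> diffn n (fun x => f x + g x).
Proof.
elim: n f g => [//|n ih] f g [f' df nf] [g' dg ng].
exists (fun x => f' x + g' x); last exact: ih.
by move=> x; apply: (@is_deriveD _ _ _ f g).
Qed.

Lemma diffn_mul n f g : diffn n f -> diffn n g -> diffn n (fun x => f x * g x).
Proof.
elim: n f g => [//|n ih] f g [f' df nf] [g' dg ng].
exists (fun x => f x * g' x + g x * f' x).
  by move=> x; apply: (@is_deriveM _ _ f g).
by apply: diffn_add; apply: ih => //; apply: diffnS; [exists f'|exists g'].
Qed.

Lemma diffn_affine n (a b : R) f : diffn n f -> diffn n (fun x => f (a * x + b)).
Proof.
elim: n f => [//|n ih] f [f' df nf].
exists (fun x => a * f' (a * x + b)).
  move=> x; rewrite mulrC.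
  have da : is_derive x (1 : R) (fun y => a * y + b) a.
    rewrite -[X in is_derive _ _ _ X]addr0.
    apply: (@is_deriveD _ _ _ ( *%R a) (cst b)).
    have -> : *%R a = (a \*: (@idfun R)) by [].
    by rewrite -[X in is_derive _ _ _ X]mulr1; apply: is_deriveZ.
  by apply: (@is_derive1_comp _ f (fun y => a * y + b)).
apply: diffn_mul; [exact: diffn_cst|exact: ih].
Qed.

Lemma smooth1_mul f g : smooth1 f -> smooth1 g -> smooth1 (fun x => f x * g x).
Proof. by move=> sf sg n; exact: diffn_mul. Qed.

Lemma smooth1_affine (a b : R) f : smooth1 f -> smooth1 (fun x => f (a * x + b)).
Proof. by move=> sf n; exact: diffn_affine. Qed.

Lemma smooth1_id : smooth1 id.
Proof.
move=> [//|n]; exists (cst 1) => [x|]; first exact: is_derive_id.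
exact: diffn_cst.
Qed.

Lemma smooth1_exprn m : smooth1 (fun x => x ^+ m).
Proof.
elim: m => [|m ih] n; first by apply: (@diffn_eq _ (cst 1)) => //; exact: diffn_cst.
apply: (@diffn_eq _ (fun x => x * x ^+ m)) => [x|]; first by rewrite exprS.
by apply: diffn_mul; [exact: smooth1_id|exact: ih].
Qed.

(** The functions y^-n exp(-c/y) on the positive half-line, extended by zero:
their span is stable under differentiation, which is why they are smooth at the
origin. *)
Definition flat c n (y : R) : R := if 0 < y then y^-1 ^+ n * expR (- (c / y)) else 0.

Lemma flat_ge0 c n y : 0 <= flat c n y.
Proof.
rewrite /flat; case: ifP => // y0.
by rewrite mulr_ge0 ?expR_ge0// exprn_ge0// invr_ge0 ltW.
Qed.

(** The exponential beats every power: exp(c/y) is at least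
(c/y)^(n+1) / (n+1)!. *)
Lemma flat_le c n : 0 < c -> exists2 K, 0 <= K & forall y, flat c n y <= K * `|y|.
Proof.
move=> c0; exists (n.+1`!%:R * c^-1 ^+ n.+1) => [|y].
  by rewrite mulr_ge0// exprn_ge0// invr_ge0 ltW.
rewrite /flat; case: ifPn => [y0|_]; last by rewrite !mulr_ge0// exprn_ge0// invr_ge0 ltW.
have u0 : 0 < c / y by rewrite divr_gt0.
have := expR_ge1Dxn n (ltW u0) => h.
have {}h : (c / y) ^+ n.+1 / n.+1`!%:R <= expR (c / y) by apply: le_trans h; rewrite lerDr.
rewrite expRN gtr0_norm//.
have e0 : 0 < (c / y) ^+ n.+1 / n.+1`!%:R by rewrite divr_gt0 ?exprn_gt0// ltr0n fact_gt0.
apply: (@le_trans _ _ (y^-1 ^+ n * ((c / y) ^+ n.+1 / n.+1`!%:R)^-1)).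
  rewrite ler_wpM2l ?exprn_ge0 ?invr_ge0 ?(ltW y0)//.
  by rewrite lef_pV2 ?posrE ?expR_gt0.
have -> : ((c / y) ^+ n.+1 / n.+1`!%:R)^-1 = n.+1`!%:R * c^-1 ^+ n.+1 * y ^+ n.+1.
  by rewrite invf_div expr_div_n invf_div exprVn -mulrA (mulrC (y ^+ _)).
rewrite mulrCA [y ^+ _]exprS [_ * (y * _)]mulrCA -exprMn mulVf ?gt_eqF//.
by rewrite expr1n mulr1.
Qed.

(** The derivative stays in the span of the family, also at the origin, where
the difference quotient is bounded by the next function of the family. *)
Lemma is_derive_flat c n (y : R) : 0 < c ->
  is_derive y (1 : R) (flat c n) (- n%:R * flat c n.+1 y + c * flat c n.+2 y).
Proof.
move=> c0; have [y0|y0|->] := ltgtP y 0.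
- rewrite /flat (lt_gtF y0) !mulr0 addr0.
  apply: (near_eq_is_derive (f := cst 0)).
  have : \forall x \near y, x < 0 by exact: lt_nbhsl.
  by apply: filterS => x x0; rewrite (lt_gtF x0).
- have fE : \near y, y^-1 ^+ n * expR (- (c / y)) = flat c n y.
    have : \forall x \near y, 0 < x by exact: lt_nbhsr.
    by apply: filterS => x x0; rewrite /flat x0.
  have dV : is_derive y (1 : R) (fun x : R => x^-1) (- y ^- 2).
    have -> : - y ^- 2 = - y ^- 2 *: 1 by rewrite [RHS]mulr1.
    apply: DeriveDef; first by apply: derivableV; rewrite ?gt_eqF//.
    by rewrite deriveV ?gt_eqF// derive_id.
  have dE : is_derive y (1 : R) (fun x : R => expR (- (c / x))) (c * y ^- 2 * expR (- (c / y))).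
    have d1 : is_derive y (1 : R) (fun x : R => - (c / x)) (c * y ^- 2).
      have -> : (fun x : R => - (c / x)) = (- c) \*: (fun x : R => x^-1).
        by apply/funext => x /=; rewrite -mulNr.
      by have := @is_deriveZ _ _ _ _ (- c) _ _ _ dV; rewrite scalerN scaleNr opprK.
    have := @is_derive1_comp _ expR (fun x : R => - (c / x)) y _ _ (is_derive_expR _) d1.
    by rewrite mulrC.
  have dX : is_derive y (1 : R) (fun x : R => x^-1 ^+ n) ((n%:R * y^-1 ^+ n.-1) *: (- y ^- 2)).
    have := @is_deriveX _ _ (fun x : R => x^-1) n y 1 _ dV.
    by rewrite (_ : _ ^+ n = (fun x : R => x^-1 ^+ n))//; apply/funext => x; rewrite fctE.
  have dM := @is_deriveM _ _ _ _ y 1 _ _ dX dE.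
  have := near_eq_is_derive fE dM; congr is_derive.
  rewrite /flat y0.
  rewrite /GRing.scale /= -exprVn.
  set Y := y^-1; set X := expR _.
  case: n {fE dX dM} => [|m]; first by rewrite /= !expr0; ring.
  by rewrite /= !exprS; ring.
have q (h : R) : `|h^-1 *: (flat c n (h *: 1 + 0) - flat c n 0)| <= flat c n.+1 h.
  rewrite /flat ltxx subr0 addr0 [_ *: 1]mulr1.
  case: ifP => h0; last by rewrite scaler0 normr0.
  rewrite /GRing.scale /= ger0_norm ?exprS ?mulrA//.
  by rewrite !mulr_ge0 ?expR_ge0 ?exprn_ge0 ?invr_ge0 ?ltW.
rewrite /flat ltxx !mulr0 addr0.
have [K K0 hK] := flat_le n.+1 c0.
have lim0 : (fun h : R => h^-1 *: (flat c n (h *: 1 + 0) - flat c n 0)) @ 0^' --> (0 : R).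
  apply/cvgrPdist_le => e e0; near=> h.
  rewrite sub0r normrN; apply: le_trans (q h) _; apply: le_trans (hK h) _.
  apply: (@le_trans _ _ (K * (e / (K + 1)))).
    by rewrite ler_wpM2l//; near: h; apply: dnbhs0_le; rewrite divr_gt0// ltr_wpDl.
  rewrite mulrCA ler_piMr ?(ltW e0)// ler_pdivrMr ?mul1r ?lerDl//.
  by rewrite ltr_wpDl.
apply: DeriveDef; first by apply/cvg_ex; exists 0.
exact/cvg_lim.
Unshelve. all: by end_near. Qed.

Lemma smooth1_flat c n : 0 < c -> smooth1 (flat c n).
Proof.
move=> c0 m; elim: m n => [//|m ih] n.
exists (fun y => - n%:R * flat c n.+1 y + c * flat c n.+2 y) => [y|].
  exact: is_derive_flat.
by apply: diffn_add; apply: diffn_mul; [exact: diffn_cst|exact: ih|exact: diffn_cst|exact: ih].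
Qed.

(** A smooth bump on the interval ]a, b[; as c tends to 0 it increases to the
indicator function of that interval. *)
Definition tbump (a b c t : R) : R := flat c 0 (t - a) * flat c 0 (b - t).

Lemma smooth1_tbump a b c : 0 < c -> smooth1 (tbump a b c).
Proof.
move=> c0; apply: smooth1_mul.
  have -> : (fun t => flat c 0 (t - a)) = (fun t => flat c 0 (1 * t + - a)).
    by apply/funext => t; rewrite mul1r.
  by apply: smooth1_affine; exact: smooth1_flat.
have -> : (fun t => flat c 0 (b - t)) = (fun t => flat c 0 (-1 * t + b)).
  by apply/funext => t; rewrite mulN1r addrC.
by apply: smooth1_affine; exact: smooth1_flat.
Qed.

Lemma tbump_ge0 a b c t : 0 <= tbump a b c t.
Proof. by rewrite mulr_ge0// flat_ge0. Qed.

Lemma tbump_le1 a b c t : 0 < c -> tbump a b c t <= 1.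
Proof.
move=> c0; have h y : flat c 0 y <= 1.
  rewrite /flat; case: ifP => // y0; rewrite expr0 mul1r expR_le1 oppr_le0.
  by rewrite divr_ge0 ?ltW.
by rewrite mulr_ile1 ?flat_ge0.
Qed.

Lemma tbump_gt0 a b c t : a < t < b -> 0 < tbump a b c t.
Proof.
move=> /andP[at_ tb]; rewrite /tbump /flat !subr_gt0 at_ tb !expr0 !mul1r.
by rewrite mulr_gt0 ?expR_gt0.
Qed.

Lemma tbump_out a b c t : ~~ (a < t < b) -> tbump a b c t = 0.
Proof.
rewrite negb_and /tbump /flat !subr_gt0 => /orP[/negbTE ->|/negbTE ->].
  by rewrite mul0r.
by rewrite mulr0.
Qed.

Lemma tbump_cvg a b t :
  (fun n => tbump a b n.+1%:R^-1 t) @ \oo --> ((a < t < b)%R%:R : R).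
Proof.
have h y : 0 < y -> (fun n => flat n.+1%:R^-1 0 y) @ \oo --> (1 : R).
  move=> y0; rewrite /flat y0.
  under eq_fun do rewrite expr0 mul1r.
  have l0 : (fun n => - (n.+1%:R^-1 / y)) @ \oo --> - (0 / y).
    by apply: cvgN; apply: cvgM; [exact: (@cvg_harmonic R)|exact: cvg_cst].
  have := cvg_comp _ _ l0 (@continuous_expR R _).
  by rewrite mul0r oppr0 expR0.
case: (boolP (a < t < b)) => tab.
  have /andP[at_ tb] := tab.
  by rewrite -[X in _ --> X](mulr1 1); apply: cvgM; apply: h; rewrite subr_gt0.
by under eq_fun do rewrite tbump_out//; exact: cvg_cst.
Qed.

End smooth_line.

(** * Smooth functions of several variables *)

Section smooth_space.
Context {R : realType} {d : nat}.
Local Notation E := 'rV[R]_d.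
Local Notation e_ i := (delta_mx ord0 i : E).
Implicit Types (f g h : E -> R) (s : seq 'I_d) (x : E).

Lemma iter_partial_near f g x s : (\near x, f x = g x) ->
  \near x, iter_partial s f x = iter_partial s g x.
Proof.
move=> fg; elim: s => [//|i s ih] /=.
move: ih => /nbhs_interior; apply: filterS => y; exact: near_eq_derive.
Qed.

(** Smoothness is a local property; this handles locally finite sums. *)
Lemma smooth_local f : (forall x, exists2 g, smooth g & \near x, f x = g x) ->
  smooth f.
Proof.
move=> loc s; split=> [x|i x]; have [g sg fg] := loc x; have [cg dg] := sg s.
- have gfs : \near x, iter_partial s g x = iter_partial s f x.
    by apply: filterS (iter_partial_near s fg) => y ->.
  rewrite /prop_for /continuous_at -(nbhs_singleton gfs).
  exact: cvg_trans (near_eq_cvg gfs) (cg x).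
- have gfs : \near x, iter_partial s g x = iter_partial s f x.
    by apply: filterS (iter_partial_near s fg) => y ->.
  exact: near_eq_derivable gfs (dg i x).
Qed.

Lemma smooth_derivable f s i x : smooth f -> derivable (iter_partial s f) x (e_ i).
Proof. by move=> sf; have [_] := sf s; apply. Qed.

Lemma smooth_continuous f s : smooth f -> continuous (iter_partial s f).
Proof. by move=> sf; have [] := sf s. Qed.

Lemma iter_partial_add f g s : smooth f -> smooth g ->
  iter_partial s (fun x => f x + g x) =
  (fun x => iter_partial s f x + iter_partial s g x).
Proof.
move=> sf sg; elim: s => [//|i s ih] /=; rewrite ih; apply/funext => x.
by rewrite (@deriveD _ _ _ (iter_partial s f) (iter_partial s g))//;
  exact: smooth_derivable.
Qed.

Lemma smooth_add f g : smooth f -> smooth g -> smooth (fun x => f x + g x).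
Proof.
move=> sf sg s; rewrite iter_partial_add//.
have [cf df] := sf s; have [cg dg] := sg s; split=> [x|i x].
  exact: (cvgD (cf x) (cg x)).
exact: (derivableD (df i x) (dg i x)).
Qed.

Lemma iter_partial_scale c f s : smooth f ->
  iter_partial s (fun x => c * f x) = (fun x => c * iter_partial s f x).
Proof.
move=> sf; elim: s => [//|i s ih] /=; rewrite ih; apply/funext => x.
by rewrite (@deriveZ _ _ _ (iter_partial s f))//; exact: smooth_derivable.
Qed.

Lemma smooth_scale c f : smooth f -> smooth (fun x => c * f x).
Proof.
move=> sf s; rewrite iter_partial_scale//; have [cf df] := sf s; split=> [x|i x].
  exact: (cvgM (cvg_cst c) (cf x)).
exact (@derivableZ _ _ _ (iter_partial s f) c x (e_ i) (df i x)).
Qed.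

Lemma iter_partial0 s : iter_partial s (fun _ : E => 0 : R) = (fun=> 0).
Proof.
elim: s => [//|i s ih] /=; rewrite ih; apply/funext => x.
exact: derive_cst.
Qed.

Lemma smooth0 : smooth (fun _ : E => 0 : R).
Proof.
move=> s; rewrite iter_partial0; split=> [|i x].
  exact: cst_continuous.
exact: derivable_cst.
Qed.

Lemma smooth_sum (I : Type) (r : seq I) (F : I -> E -> R) :
  (forall i, smooth (F i)) -> smooth (fun x => \sum_(i <- r) F i x).
Proof.
move=> sF; elim: r => [|i r ih].
  have -> : (fun x => \sum_(i <- [::]) F i x) = (fun=> 0).
    by apply/funext => x; rewrite big_nil.
  exact: smooth0.
have -> : (fun x => \sum_(j <- i :: r) F j x) =
          (fun x => F i x + \sum_(j <- r) F j x).
  by apply/funext => x; rewrite big_cons.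
exact: smooth_add.
Qed.

Lemma iter_partial_sum (I : Type) (r : seq I) (F : I -> E -> R) s :
  (forall i, smooth (F i)) ->
  iter_partial s (fun x => \sum_(i <- r) F i x) =
  (fun x => \sum_(i <- r) iter_partial s (F i) x).
Proof.
move=> sF; elim: r => [|i r ih].
  rewrite (_ : (fun x => \sum_(i <- [::]) F i x) = (fun=> 0)).
    by rewrite iter_partial0; apply/funext => x; rewrite big_nil.
  by apply/funext => x; rewrite big_nil.
rewrite (_ : (fun x => \sum_(j <- i :: r) F j x) =
          (fun x => F i x + \sum_(j <- r) F j x)).
  rewrite iter_partial_add//; last exact: smooth_sum.
  by apply/funext => x; rewrite big_cons ih.
by apply/funext => x; rewrite big_cons.
Qed.

Lemma is_derive_dilate (c : R) f x (v : E) (df : R) : c != 0 ->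
  is_derive (c *: x) v f df -> is_derive x v (fun y => f (c *: y)) (c * df).
Proof.
move=> c0 [dff <-].
have cv : (fun t : R => t^-1 *: (f (c *: (t *: v + x)) - f (c *: x))) @ 0^' -->
    c * 'D_v f (c *: x).
  have -> : (fun t : R => t^-1 *: (f (c *: (t *: v + x)) - f (c *: x))) =
     (fun t => c * ((fun u => u^-1 *: (f (u *: v + c *: x) - f (c *: x))) (c * t))).
    apply/funext => t; rewrite [c *: (_ + _)]scalerDr [c *: (t *: v)]scalerA.
    by rewrite /GRing.scale /= mulrA invfM mulrA mulfV// mul1r.
  have lim : (fun t : R => c * t) @ 0^' --> (0 : R)^'.
    have := @continuous_injective_withinNx R R ( *%R c) 0 (@mulrl_continuous R c 0).
    by rewrite mulr0; apply => t /eqP; rewrite mulf_eq0 (negbTE c0) => /eqP.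
  apply: (cvgM (cvg_cst c)).
  exact: (@cvg_comp _ _ _ (fun t => c * t)
    (fun u : R => u^-1 *: (f (u *: v + c *: x) - f (c *: x))) _ _ _ lim dff).
apply: DeriveDef; first by apply/cvg_ex; exists (c * 'D_v f (c *: x)).
exact/cvg_lim.
Qed.

Lemma iter_partial_dilate (c : R) f s : c != 0 -> smooth f ->
  iter_partial s (fun x => f (c *: x)) =
  (fun x => c ^+ size s * iter_partial s f (c *: x)).
Proof.
move=> c0 sf; elim: s => [|i s ih] /=; first by apply/funext => x; rewrite mul1r.
rewrite ih; apply/funext => x.
have h : is_derive x (e_ i) (fun y => iter_partial s f (c *: y))
    (c * 'D_(e_ i) (iter_partial s f) (c *: x)).
  by apply: is_derive_dilate => //; apply/derivableP; exact: smooth_derivable.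
rewrite (@deriveZ _ _ _ (fun y => iter_partial s f (c *: y))); last exact: ex_derive.
by rewrite derive_val /GRing.scale /= exprS mulrCA mulrA.
Qed.

Lemma smooth_dilate (c : R) f : c != 0 -> smooth f -> smooth (fun x => f (c *: x)).
Proof.
move=> c0 sf s; rewrite iter_partial_dilate//.
have cf : continuous (fun x : E => iter_partial s f (c *: x)).
  move=> x; have cs : c *: y @[y --> x] --> c *: x by exact: scaler_continuous.
  exact: (cvg_comp _ _ cs (@smooth_continuous f s sf (c *: x))).
split=> [x|i x]; first exact: (cvgM (cvg_cst (c ^+ size s)) (cf x)).
have h : is_derive x (e_ i) (fun y => iter_partial s f (c *: y))
    (c * 'D_(e_ i) (iter_partial s f) (c *: x)).
  by apply: is_derive_dilate => //; apply/derivableP; exact: smooth_derivable.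
exact (@derivableZ _ _ _ (fun y => iter_partial s f (c *: y)) _ x (e_ i)
  (@ex_derive _ _ _ _ _ _ _ h)).
Qed.

Definition tensor (F : 'I_d -> R -> R) x : R := \prod_i F i (x ord0 i).

Lemma continuous_prod (I : Type) (r : seq I) (F : I -> E -> R) :
  (forall i, continuous (F i)) -> continuous (fun x => \prod_(i <- r) F i x).
Proof.
move=> cF; elim: r => [|i r ih].
  have -> : (fun x => \prod_(i <- [::]) F i x) = cst 1.
    by apply/funext => x; rewrite big_nil.
  exact: cst_continuous.
have -> : (fun x => \prod_(j <- i :: r) F j x) =
          (fun x => F i x * \prod_(j <- r) F j x).
  by apply/funext => x; rewrite big_cons.
by move=> x; exact: (cvgM (cF i x) (ih x)).
Qed.

Lemma continuous_tensor F : (forall i, continuous (F i)) -> continuous (tensor F).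
Proof.
move=> cF; apply: continuous_prod => i x.
have cc : y ord0 i @[y --> x] --> x ord0 i by exact: coord_continuous.
exact: (cvg_comp _ _ cc (cF i (x ord0 i))).
Qed.

(** Only the factor of index i moves along the i-th coordinate direction, so the
class of tensor products is stable under partial derivatives. *)
Lemma is_derive_tensor F i x : (forall j, smooth1 (F j)) ->
  is_derive x (e_ i) (tensor F) (tensor (fun j => if j == i then derive1 (F i) else F j) x).
Proof.
move=> sF; have [dF _] := smooth1_derive (sF i).
pose P := \prod_(j | j != i) F j (x ord0 j).
have cv : (fun t : R => t^-1 *: (tensor F (t *: e_ i + x) - tensor F x)) @ 0^' -->
    P * derive1 (F i) (x ord0 i).
  have -> : (fun t : R => t^-1 *: (tensor F (t *: e_ i + x) - tensor F x)) =
      (fun t : R => P * (t^-1 *: (F i (t *: 1 + x ord0 i) - F i (x ord0 i)))).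
    apply/funext => t; rewrite /tensor (bigD1 i)//= [X in _ - X](bigD1 i)//=.
    rewrite !mxE !eqxx /= (eq_bigr (fun j => F j (x ord0 j))); last first.
      by move=> j ji; rewrite !mxE (negbTE ji) andbF mulr0 add0r.
    by rewrite -/P -mulrBl /GRing.scale /= mulrA mulrC.
  apply: (cvgM (cvg_cst P)).
  by have [dfi <-] := dF (x ord0 i).
have -> : tensor (fun j => if j == i then derive1 (F i) else F j) x =
    P * derive1 (F i) (x ord0 i).
  rewrite /tensor (bigD1 i)//= eqxx mulrC; congr (_ * _).
  by apply: eq_bigr => j /negbTE ->.
apply: DeriveDef; first by apply/cvg_ex; eexists; exact: cv.
exact/cvg_lim.
Qed.

Lemma iter_partial_tensor F s : (forall j, smooth1 (F j)) ->
  exists2 G, (forall j, smooth1 (G j)) & iter_partial s (tensor F) = tensor G.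
Proof.
move=> sF; elim: s => [|i s [G sG ih]] /=; first by exists F.
exists (fun j => if j == i then derive1 (G i) else G j).
  by move=> j; case: eqP => // _; have [] := smooth1_derive (sG i).
rewrite ih; apply/funext => x; have := is_derive_tensor i x sG.
by move=> h; rewrite derive_val.
Qed.

Lemma smooth_tensor F : (forall j, smooth1 (F j)) -> smooth (tensor F).
Proof.
move=> sF s; have [G sG ->] := iter_partial_tensor s sF; split=> [|i x].
  by apply: continuous_tensor => i; exact: smooth1_continuous.
by have h := is_derive_tensor i x sG; exact: ex_derive.
Qed.

Definition test_fun f := smooth f /\ exists K, forall x, K < `|x| -> f x = 0.

Lemma iter_partial_vanish f s (K : R) : (forall x, K < `|x| -> f x = 0) ->
  forall x, K < `|x| -> iter_partial s f x = 0.
Proof.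
move=> fK x xK.
have oK : open [set x : E | K < `|x|].
  rewrite (_ : [set x : E | K < `|x|] = (fun x : E => `|x|) @^-1` `]K, +oo[%classic).
    by apply: open_comp; [move=> y _; exact: norm_continuous|exact: interval_open].
  by apply/seteqP; split => y /=; rewrite in_itv /= andbT.
have op : \near x, K < `|x| by exact: (open_nbhs_nbhs (conj oK xK)).
have f0 : \near x, f x = (fun=> 0) x by apply: filterS op => y; exact: fK.
by have /nbhs_singleton := iter_partial_near s f0; rewrite iter_partial0.
Qed.

(** A partial derivative also vanishes outside a ball, and it is bounded on the
ball by compactness. *)
Lemma test_fun_bounded f s : test_fun f ->
  exists2 C, 0 <= C & forall x, `|iter_partial s f x| <= C.
Proof.
move=> [sf [K fK]].
have K0 : 0 <= `|K| + 1 by rewrite addr_ge0.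
have cB : compact [set x : E | `|x| <= `|K| + 1].
  apply: bounded_closed_compact.
    by exists (`|K| + 1); split => [|M M1 x /= xK]; [exact: num_real|exact: le_trans xK (ltW M1)].
  rewrite (_ : [set x : E | _] = (fun x : E => `|x|) @^-1` `]-oo, (`|K| + 1)]%classic).
    by apply: closed_comp; [move=> y _; exact: norm_continuous|exact: interval_closed].
  by apply/seteqP; split => y /=; rewrite in_itv.
have cf : {within [set x : E | `|x| <= `|K| + 1], continuous (fun x => `|iter_partial s f x|)}.
  apply: continuous_subspaceT => x.
  apply: continuous_comp; last exact: norm_continuous.
  exact: smooth_continuous.
have [|c _ hc] := EVT_max_rV _ cB cf; first by exists 0; rewrite /= normr0.
exists `|iter_partial s f c| => // x.
have [xK|xK] := leP `|x| (`|K| + 1); first by apply: hc; rewrite inE.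
rewrite (iter_partial_vanish s fK) ?normr0//.
by apply: le_lt_trans xK; rewrite (le_trans (ler_norm K))// lerDl.
Qed.

Lemma test_fun_add f g : test_fun f -> test_fun g -> test_fun (fun x => f x + g x).
Proof.
move=> [sf [K fK]] [sg [L gL]]; split; first exact: smooth_add.
by exists (Num.max K L) => x; rewrite gt_max => /andP[/fK -> /gL ->]; rewrite addr0.
Qed.

Lemma test_fun_scale c f : test_fun f -> test_fun (fun x => c * f x).
Proof.
move=> [sf [K fK]]; split; first exact: smooth_scale.
by exists K => x /fK ->; rewrite mulr0.
Qed.

Lemma test_fun0 : test_fun (fun=> 0).
Proof. by split; [exact: smooth0|exists 0]. Qed.

Lemma test_fun_sum (I : Type) (r : seq I) (F : I -> E -> R) :
  (forall i, test_fun (F i)) -> test_fun (fun x => \sum_(i <- r) F i x).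
Proof.
move=> tF; elim: r => [|i r ih].
  have -> : (fun x => \sum_(i <- [::]) F i x) = (fun=> 0).
    by apply/funext => x; rewrite big_nil.
  exact: test_fun0.
have -> : (fun x => \sum_(j <- i :: r) F j x) =
          (fun x => F i x + \sum_(j <- r) F j x).
  by apply/funext => x; rewrite big_cons.
exact: test_fun_add.
Qed.

End smooth_space.

(** * Test functions are dense in weighted Lp spaces *)

Section density.
Context {R : realType} {d : nat}.
Local Notation E := 'rV[R]_d.
Variables (nu : {measure set E -> \bar R}) (p : R).
Hypotheses (p1 : 1 <= p) (nu_cube : forall n, (nu (cube n) < +oo)%E).
Implicit Types f g : E -> R.

Let p0 : 0 < p. Proof. exact: lt_le_trans p1. Qed.

Definition Lp_norm f : \bar R := 'N[nu]_p%:E[EFin \o f].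

Lemma Lp_normE f : Lp_norm f = ((\int[nu]_x (`|f x| `^ p)%:E) `^ p^-1)%E.
Proof. by rewrite /Lp_norm unlock. Qed.

Lemma Lp_norm_lt f (e : R) : 0 < e -> (\int[nu]_x (`|f x| `^ p)%:E < (e `^ p)%:E)%E ->
  (Lp_norm f < e%:E)%E.
Proof.
move=> e0 fe; rewrite Lp_normE.
have I0 : (0 <= \int[nu]_x (`|f x| `^ p)%:E)%E.
  by apply: integral_ge0 => x _; rewrite lee_fin powR_ge0.
move: fe I0; case: (\int[nu]_x _)%E => [r||]//; rewrite lte_fin lee_fin => re r0.
rewrite poweR_EFin lte_fin.
have -> : e = (e `^ p) `^ p^-1 by rewrite -powRrM mulfV ?gt_eqF// powRr1 ?ltW.
by apply: gt0_ltr_powR; rewrite ?invr_gt0// nnegrE// powR_ge0.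
Qed.

Lemma Lp_norm_triangle f g : measurable_fun setT f -> measurable_fun setT g ->
  (Lp_norm (fun x => (f x + g x)%R) <= Lp_norm f + Lp_norm g)%E.
Proof. by move=> mf mg; exact (minkowski_EFin nu mf mg p1). Qed.

Lemma Lp_normZ (c : R) f : measurable_fun setT f ->
  Lp_norm (fun x => c * f x) = (`|c|%:E * Lp_norm f)%E.
Proof.
move=> mf; rewrite !Lp_normE.
have mp : measurable_fun setT (fun x => `|f x| `^ p).
  apply: (measurableT_comp (measurable_powR p)); exact: measurableT_comp.
under eq_integral do rewrite normrM powRM// EFinM.
rewrite (@ge0_integralZl _ _ _ nu setT measurableT _ _ (`|c| `^ p)%:E); last 3 first.
- exact/measurable_EFinP.
- by move=> x _; rewrite lee_fin powR_ge0.
- by rewrite lee_fin powR_ge0.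
rewrite poweRM ?lee_fin ?powR_ge0//; last first.
  by apply: integral_ge0 => x _; rewrite lee_fin powR_ge0.
by rewrite poweR_EFin -powRrM mulfV ?gt_eqF// powRr1.
Qed.

(** Dominated convergence for the p-th power of the difference. *)
Lemma Lp_norm_cvg (f_ : (E -> R)^nat) f (G : E -> R) :
  (forall n, measurable_fun setT (f_ n)) -> measurable_fun setT f ->
  measurable_fun setT G -> (\int[nu]_x (G x)%:E < +oo)%E ->
  (forall n x, `|f x - f_ n x| `^ p <= G x) ->
  (forall x, f_ ^~ x @ \oo --> f x) ->
  forall e : R, 0 < e -> exists n, (Lp_norm (fun x => (f x - f_ n x)%R) < e%:E)%E.
Proof.
move=> mf_ mf mG Goo fG ff e e0.
have G0 x : 0 <= G x by apply: le_trans (fG 0%N x); rewrite powR_ge0.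
pose D n x := (`|f x - f_ n x| `^ p)%:E.
have mD n : measurable_fun setT (D n).
  apply/measurable_EFinP; apply: (measurableT_comp (measurable_powR p)).
  by apply: measurableT_comp => //; exact: measurable_funB.
have iG : nu.-integrable setT (EFin \o G).
  apply/integrableP; split; first exact/measurable_EFinP.
  by under eq_integral do rewrite gee0_abs ?lee_fin//.
have Dcvg x : D ^~ x @ \oo --> (cst 0%E) x.
  apply: cvg_EFin; first by apply: nearW.
  have /cvgr0Pnorm_lt hl : (fun n => f x - f_ n x) @ \oo --> (0 : R).
    rewrite -(subrr (f x)); apply: cvgB; [exact: cvg_cst|exact: ff].
  apply/cvgr0Pnorm_lt => eps eps0.
  have e'0 : 0 < eps `^ p^-1 by rewrite powR_gt0.
  have := hl _ e'0; apply: filterS => n hn.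
  rewrite /= ger0_norm ?powR_ge0//.
  have -> : eps = (eps `^ p^-1) `^ p by rewrite -powRrM mulVf ?gt_eqF// powRr1 ?ltW.
  by apply: gt0_ltr_powR => //; rewrite nnegrE// ltW.
have DG x n : setT x -> (`|D n x| <= (EFin \o G) x)%E.
  by move=> _; rewrite gee0_abs ?lee_fin ?powR_ge0.
have [_ _] := dominated_convergence measurableT mD (measurable_cst 0%E)
  (aeW nu (fun x _ => Dcvg x)) iG (aeW nu DG).
rewrite integral_cst// mul0e => /(_ [set y | (y < (e `^ p)%:E)%E]).
case.
  apply: open_nbhs_nbhs; split; first exact: open_ereal_lt_ereal.
  by rewrite /= lte_fin powR_gt0.
move=> N _ /(_ N (leqnn N)) /= hN; exists N.
exact: Lp_norm_lt.
Qed.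

(** The norm of f itself is not required to be finite, so that no integrability
has to be carried through the closure properties. *)
Definition approximable f := measurable_fun setT f /\
  forall e : R, 0 < e -> exists2 g, test_fun g &
    (Lp_norm (fun x => (f x - g x)%R) < e%:E)%E.

Lemma measurable_test_fun f : test_fun f -> measurable_fun setT f.
Proof.
move=> [sf _]; apply: continuous_measurable_rV.
exact: (@smooth_continuous _ _ f [::]).
Qed.

Lemma approximable_add f g : approximable f -> approximable g ->
  approximable (fun x => f x + g x).
Proof.
move=> [mf af] [mg ag]; split; first exact: measurable_funD.
move=> e e0; have e20 : 0 < e / 2 by rewrite divr_gt0.
have [u tu fu] := af _ e20; have [v tv gv] := ag _ e20.
exists (fun x => u x + v x); first exact: test_fun_add.
rewrite (_ : (fun x => _) = (fun x => (f x - u x) + (g x - v x))); last first.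
  by apply/funext => x; rewrite opprD addrACA.
apply: le_lt_trans (Lp_norm_triangle _ _) _.
- by apply: measurable_funB => //; exact: measurable_test_fun.
- by apply: measurable_funB => //; exact: measurable_test_fun.
by rewrite (splitr e) EFinD; apply: lteD.
Qed.

Lemma approximable_scale (c : R) f : approximable f -> approximable (fun x => c * f x).
Proof.
move=> [mf af]; split; first exact: measurable_funM.
move=> e e0; have ec0 : 0 < e / (`|c| + 1) by rewrite divr_gt0// ltr_wpDl.
have [u tu fu] := af _ ec0.
exists (fun x => c * u x); first exact: test_fun_scale.
rewrite (_ : (fun x => _) = (fun x => c * (f x - u x))); last first.
  by apply/funext => x; rewrite mulrBr.
rewrite Lp_normZ; last by apply: measurable_funB => //; exact: measurable_test_fun.
apply: (@le_lt_trans _ _ (`|c|%:E * (e / (`|c| + 1))%:E)%E).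
  by apply: lee_wpmul2l; [rewrite lee_fin|exact: ltW].
by rewrite -EFinM lte_fin mulrCA gtr_pMr// ltr_pdivrMr ?mul1r ?ltrDl// ltr_wpDl.
Qed.

Lemma approximable_lim (f_ : (E -> R)^nat) f : measurable_fun setT f ->
  (forall n, approximable (f_ n)) ->
  (forall e : R, 0 < e -> exists n, (Lp_norm (fun x => (f x - f_ n x)%R) < e%:E)%E) ->
  approximable f.
Proof.
move=> mf af h; split => // e e0; have e20 : 0 < e / 2 by rewrite divr_gt0.
have [n hn] := h _ e20; have [mfn /(_ _ e20)[g tg fg]] := af n.
exists g => //.
rewrite (_ : (fun x => _) = (fun x => (f x - f_ n x) + (f_ n x - g x))); last first.
  by apply/funext => x; rewrite addrA subrK.
apply: le_lt_trans (Lp_norm_triangle _ _) _.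
- exact: measurable_funB.
- by apply: measurable_funB => //; exact: measurable_test_fun.
by rewrite (splitr e) EFinD; apply: lteD.
Qed.

Lemma approximable_test f : test_fun f -> approximable f.
Proof.
move=> tf; split; first exact: measurable_test_fun.
move=> e e0; exists f => //; apply: Lp_norm_lt => //.
under eq_integral do rewrite subrr normr0 powR0 ?gt_eqF//.
by rewrite integral0 lte_fin powR_gt0.
Qed.

Lemma approximable_sum (I : Type) (r : seq I) (F : I -> E -> R) :
  (forall i, approximable (F i)) -> approximable (fun x => \sum_(i <- r) F i x).
Proof.
move=> aF; elim: r => [|i r ih].
  have -> : (fun x => \sum_(i <- [::]) F i x) = (fun=> 0).
    by apply/funext => x; rewrite big_nil.
  exact/approximable_test/test_fun0.
have -> : (fun x => \sum_(j <- i :: r) F j x) =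
          (fun x => F i x + \sum_(j <- r) F j x).
  by apply/funext => x; rewrite big_cons.
exact: approximable_add.
Qed.

Let measurable_cube n : measurable (@cube R d n).
Proof. exact: measurable_open_box. Qed.

Let cvg_bigprod (I : Type) (r : seq I) (u : I -> nat -> R) (l : I -> R) :
  (forall i, u i @ \oo --> l i) ->
  (fun n => \prod_(i <- r) u i n) @ \oo --> \prod_(i <- r) l i.
Proof.
move=> ul; elim: r => [|i r ih].
  by rewrite big_nil; under eq_fun do rewrite big_nil; exact: cvg_cst.
by rewrite big_cons; under eq_fun do rewrite big_cons; exact: (cvgM (ul i) ih).
Qed.

Lemma box_in_cube a b : exists n, @open_box R d a b `<=` cube n.
Proof.
pose M := \sum_i (`|a i| + `|b i|).
have hM i : `|a i| <= M /\ `|b i| <= M.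
  rewrite /M (bigD1 i)//=; have : 0 <= \sum_(j | j != i) (`|a j| + `|b j|).
    by apply: sumr_ge0 => j _; rewrite addr_ge0.
  have := normr_ge0 (a i); have := normr_ge0 (b i).
  by move: (\sum_(j | _) _) => S; split; lra.
have Mn : M < (Num.trunc M).+1%:R by exact: truncnS_gt.
exists (Num.trunc M).+1 => x /= xab i; have [aM bM] := hM i.
have /andP[ax xb] := xab i; apply/andP; split.
  apply: lt_trans ax; rewrite ltrNl; apply: le_lt_trans Mn.
  by apply: le_trans aM; rewrite -normrN ler_norm.
by apply: lt_trans xb _; apply: le_lt_trans Mn; exact: le_trans (ler_norm _) bM.
Qed.

Let integral_indic_lty (A : set E) : measurable A -> (nu A < +oo)%E ->
  (\int[nu]_x (\1_A x)%:E < +oo)%E.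
Proof. by move=> mA nA; rewrite integral_indic// setIT. Qed.

(** Products of bumps increase to the indicator function of the box as the
parameter of the bumps tends to 0. *)
Lemma approximable_box a b : approximable (\1_(open_box a b) : E -> R).
Proof.
pose f_ n : E -> R := tensor (fun i => tbump (a i) (b i) n.+1%:R^-1).
have f_le1 n x : 0 <= f_ n x <= 1.
  apply/andP; split; first by apply: prodr_ge0 => i _; exact: tbump_ge0.
  by apply: prodr_ile1 => i _; rewrite tbump_ge0 tbump_le1 ?invr_gt0.
have f_out n x : ~ open_box a b x -> f_ n x = 0.
  move=> /existsNP[i /negP xi]; apply/eqP/prodf_eq0; exists i => //.
  by rewrite tbump_out.
have boxE (x : E) : \1_(open_box a b) x = \prod_i ((a i < x ord0 i < b i)%R%:R : R).
  rewrite indicE; case: (boolP (x \in _)); rewrite ?inE ?notin_setE /=.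
    by move=> xab; rewrite big1// => i _; rewrite xab.
  move=> /existsNP[i /negP/negbTE xi]; apply/esym/eqP/prodf_eq0; exists i => //.
  by rewrite xi.
have tf n : test_fun (f_ n).
  split; first by apply: smooth_tensor => i; apply: smooth1_tbump; rewrite invr_gt0.
  have [N hN] := box_in_cube a b; exists N%:R => x xN; apply: f_out => /hN xc.
  move: xN; apply/negP; rewrite -leNgt; apply/norm_rV_le => // i.
  by rewrite ler_norml; have /andP[/ltW -> /ltW ->] := xc i.
have mbox : measurable_fun setT (\1_(open_box a b) : E -> R).
  by apply: measurable_indic; exact: measurable_open_box.
apply: (@approximable_lim f_) => //.
  by move=> n; exact/approximable_test/tf.
apply: (@Lp_norm_cvg _ _ (\1_(open_box a b) : E -> R)) => //.
- by move=> n; exact: (measurable_test_fun (tf n)).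
- apply: integral_indic_lty; first exact: measurable_open_box.
  have [N hN] := box_in_cube a b; apply: le_lt_trans (nu_cube N).
  by apply: le_measure => //; rewrite inE; exact: measurable_open_box.
- move=> n x; rewrite indicE; case: (boolP (x \in _)); rewrite ?inE ?notin_setE.
    move=> _; have p11 : 1 `^ p = 1 :> R by rewrite powR1.
    rewrite -[leRHS]p11.
    have /andP[h1 h2] := f_le1 n x.
    apply: ge0_ler_powR; rewrite ?nnegrE ?(ltW p0)//.
    by rewrite ger0_norm ?subr_ge0//= lerBlDr lerDl.
  by move=> /f_out ->; rewrite subr0 normr0 powR0// gt_eqF.
- move=> x; rewrite boxE; apply: cvg_bigprod => i; exact: tbump_cvg.
Qed.

(** Dynkin induction from the boxes. Intersecting with a fixed cube keeps all
measures finite, so that complements become differences of integrable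
functions. *)
Lemma approximable_cube (A : set E) n : measurable A ->
  approximable (\1_(A `&` cube n) : E -> R).
Proof.
move=> mA.
suff : forall S, <<s @open_boxes R d >> S -> approximable (\1_(S `&` cube n) : E -> R).
  by apply; rewrite -measurable_rVE.
apply: (dynkin_induction (G := open_boxes)).
- exact: measurable_rVE.
- exact: open_boxes_setI.
- by rewrite setTI; exact: approximable_box.
- move=> _ [a [b ->]].
  have [a' [b' ->]] : open_boxes (open_box a b `&` cube n).
    by apply: open_boxes_setI; eexists; eexists; reflexivity.
  exact: approximable_box.
- move=> S mS aS.
  have -> : (\1_(~` S `&` cube n) : E -> R) =
      (fun x => \1_(cube n) x + -1 * \1_(S `&` cube n) x).
    apply/funext => x; rewrite !indicE !in_setI in_setC.
    by case: (x \in S); case: (x \in cube n); rewrite /= ?mulr0 ?mulr1 ?addr0 ?subrr.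
  apply: approximable_add; first exact: approximable_box.
  exact: approximable_scale.
- move=> F mF tF aF.
  have mU : measurable (\bigcup_k F k) by exact: bigcupT_measurable.
  pose f_ m (x : E) : R := \sum_(k <- iota 0 m) \1_(F k `&` cube n) x.
  (* by disjointness the partial sums at x jump at most once, from 0 to 1 *)
  have fE (x : E) : (forall m, f_ m x = 0) /\ \1_(\bigcup_k F k `&` cube n) x = 0 :> R \/
      exists k0, (forall m, f_ m x = (k0 < m)%N%:R) /\
        \1_(\bigcup_k F k `&` cube n) x = 1 :> R.
    have [[[k0 _ Fx] cx]|Ux] := pselect ((\bigcup_k F k `&` cube n) x); [right|left].
      exists k0; split=> [m|]; last by rewrite indicE mem_set//; split => //; exists k0.
      have F1 k : \1_(F k `&` cube n) x = (k == k0)%:R :> R.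
        rewrite indicE; have [->|kk0] := eqVneq k k0; first by rewrite mem_set.
        rewrite memNset// => -[Fk _]; move/trivIsetP : tF => /(_ k k0 I I kk0).
        by move=> /seteqP[/(_ x) + _]; apply.
      rewrite /f_; under eq_bigr do rewrite F1.
      rewrite -natr_sum; congr (_%:R).
      transitivity (count_mem k0 (iota 0 m)).
        by rewrite -sum1_count [RHS]big_mkcond; apply: eq_bigr => k _ /=; case: eqP.
      by rewrite count_uniq_mem ?iota_uniq// mem_iota add0n.
    split=> [m|]; last by rewrite indicE memNset.
    rewrite /f_ big1// => k _; rewrite indicE memNset// => -[Fk cx]; apply: Ux.
    by split => //; exists k.
  apply: (@approximable_lim f_).
  - by apply: measurable_indic; exact: measurableI.
  - by move=> m; exact: approximable_sum.
  apply: (@Lp_norm_cvg _ _ (\1_(cube n) : E -> R)).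
  - move=> m; apply: measurable_sum => k.
    by apply: measurable_indic; exact: measurableI.
  - by apply: measurable_indic; exact: measurableI.
  - exact: measurable_indic.
  - exact: integral_indic_lty.
  - move=> m x.
    have [xc|xc] := pselect (cube n x); last first.
      have o (S : set E) : \1_(S `&` cube n) x = 0 :> R.
        by rewrite indicE memNset// => -[].
      rewrite o /f_ big1; last by move=> k _; exact: o.
      by rewrite subr0 normr0 powR0 ?gt_eqF// indicE.
    rewrite [leRHS]indicE mem_set//.
    have p11 : 1 `^ p = 1 :> R by rewrite powR1.
    rewrite -[leRHS]p11; apply: ge0_ler_powR; rewrite ?nnegrE ?(ltW p0)//.
    have [[-> ->]|[k0 [-> ->]]] := fE x; first by rewrite subr0 normr0.
    by case: (k0 < m)%N; rewrite ?subr0 ?subrr ?normr0 ?normr1.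
  - move=> x; have [[h ->]|[k0 [h ->]]] := fE x.
      by rewrite (_ : f_ ^~ x = cst 0); [exact: cvg_cst|apply/funext].
    apply/cvgrPdist_lt => e e0; exists k0.+1 => // m /= k0m.
    by rewrite h k0m subrr normr0.
Qed.

Lemma cube_le m n : (m <= n)%N -> @cube R d m `<=` cube n.
Proof.
move=> mn x xm i; have /andP[h1 h2] := xm i.
have mnR : m%:R <= n%:R :> R by rewrite ler_nat.
by rewrite (le_lt_trans _ h1) ?lerN2// (lt_le_trans h2).
Qed.

Lemma approximable_indic (A : set E) : measurable A -> (nu A < +oo)%E ->
  approximable (\1_A : E -> R).
Proof.
move=> mA nA; apply: (@approximable_lim (fun n => \1_(A `&` cube n) : E -> R)).
- exact: measurable_indic.
- by move=> n; exact: approximable_cube.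
apply: (@Lp_norm_cvg _ _ (\1_A : E -> R)).
- by move=> n; apply: measurable_indic; exact: measurableI.
- exact: measurable_indic.
- exact: measurable_indic.
- exact: integral_indic_lty.
- move=> n x; rewrite !indicE in_setI.
  by case: (x \in A); case: (x \in cube n);
    rewrite /= ?subr0 ?subrr ?normr0 ?normr1 ?powR1 ?powR0 ?gt_eqF.
- move=> x; have [N _ xN] : (\bigcup_n cube n) x by rewrite cube_cover.
  apply/cvgrPdist_lt => e e0; exists N => // m /= Nm.
  have /mem_set xm := cube_le Nm xN.
  by rewrite !indicE in_setI xm andbT subrr normr0.
Qed.

Import HBNNSimple.

Lemma approximable_nnsfun (g : {nnsfun E >-> R}) :
  (\int[nu]_x (`|g x| `^ p)%:E < +oo)%E -> approximable g.
Proof.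
move=> gp.
have -> : (g : E -> R) = (fun x => \sum_(y <- fset_set (range g)) y * \1_(g @^-1` [set y]) x).
  by apply/funext => x; rewrite fimfunE fsbig_finite.
apply: approximable_sum => y.
have mA : measurable (g @^-1` [set y]) by exact: measurable_funPTI.
have [y0|y0] := leP y 0.
  have -> : (fun x => y * \1_(g @^-1` [set y]) x) = (fun=> 0).
    apply/funext => x; move: y0; rewrite le_eqVlt => /predU1P[->|y0].
      by rewrite mul0r.
    by rewrite preimage_nnfun0// indic0 mulr0.
  exact/approximable_test/test_fun0.
apply/approximable_scale/approximable_indic => //.
have yp0 : 0 < y `^ p by rewrite powR_gt0.
have : (\int[nu]_x ((y `^ p)%:E * (\1_(g @^-1` [set y]) x)%:E) < +oo)%E.
  apply: le_lt_trans gp; apply: ge0_le_integral.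
  - exact: measurableT.
  - by move=> x _; rewrite -EFinM lee_fin mulr_ge0 ?powR_ge0.
  - by apply: measurable_funeM; apply/measurable_EFinP; exact: measurable_indic.
  - apply/measurable_EFinP; apply: (measurableT_comp (measurable_powR p)).
    exact: measurableT_comp.
  move=> x _; rewrite -EFinM lee_fin indicE; case: (boolP (x \in _)); rewrite ?inE /=.
    by move=> ->; rewrite mulr1 gtr0_norm.
  by move=> _; rewrite mulr0 powR_ge0.
rewrite ge0_integralZl//; last 2 first.
- by apply/measurable_EFinP; exact: measurable_indic.
- by rewrite lee_fin ltW.
rewrite integral_indic// setIT; case: (nu _) => [r _|//|//]; first exact: ltry.
by rewrite gt0_muley ?lte_fin.
Qed.

Lemma approximable_ge0 f : measurable_fun setT f -> (forall x, 0 <= f x) ->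
  (\int[nu]_x (`|f x| `^ p)%:E < +oo)%E -> approximable f.
Proof.
move=> mf f0 fp.
have mf' : measurable_fun setT (EFin \o f) by exact/measurable_EFinP.
pose g := nnsfun_approx measurableT mf'.
have f0' x : setT x -> (0 <= (EFin \o f) x)%E by move=> _; rewrite lee_fin.
have gf n x : g n x <= f x.
  have := le_approx n f0' (I : setT x).
  by rewrite /g nnsfun_approxE lee_fin.
have mfp : measurable_fun setT (fun x => `|f x| `^ p).
  by apply: (measurableT_comp (measurable_powR p)); exact: measurableT_comp.
apply: (@approximable_lim (fun n => g n)) => //.
  move=> n; apply: approximable_nnsfun; apply: le_lt_trans fp.
  apply: ge0_le_integral.
  - exact: measurableT.
  - by move=> x _; rewrite lee_fin powR_ge0.
  - apply/measurable_EFinP; apply: (measurableT_comp (measurable_powR p)).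
    exact: measurableT_comp.
  - exact/measurable_EFinP.
  move=> x _; rewrite lee_fin; apply: ge0_ler_powR; rewrite ?nnegrE ?(ltW p0)//.
  by rewrite !ger0_norm.
apply: (@Lp_norm_cvg _ _ (fun x => `|f x| `^ p)) => //.
- move=> n x; apply: ge0_ler_powR; rewrite ?nnegrE ?(ltW p0)//.
  by rewrite !ger0_norm ?subr_ge0// lerBlDr lerDl.
- move=> x; have := cvg_nnsfun_approx measurableT mf' f0' (I : setT x).
  by move=> /fine_cvgP[_].
Qed.

(** From indicator functions to simple functions, to nonnegative functions, and
to the difference of positive and negative parts. *)
Lemma test_fun_dense f : measurable_fun setT f ->
  (\int[nu]_x (`|f x| `^ p)%:E < +oo)%E -> approximable f.
Proof.
move=> mf fp.
have h (u : E -> R) : measurable_fun setT u -> (forall x, `|u x| = `|f x|) ->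
    approximable (fun x => Num.max (u x) 0).
  move=> mu uf; have mm : measurable_fun setT (fun x => Num.max (u x) 0).
    exact: measurable_maxr.
  apply: approximable_ge0 => //; first by move=> x; rewrite le_max lexx orbT.
  apply: le_lt_trans fp; apply: ge0_le_integral.
  - exact: measurableT.
  - by move=> x _; rewrite lee_fin powR_ge0.
  - apply/measurable_EFinP; apply: (measurableT_comp (measurable_powR p)).
    exact: measurableT_comp.
  - apply/measurable_EFinP; apply: (measurableT_comp (measurable_powR p)).
    exact: measurableT_comp.
  move=> x _; rewrite lee_fin; apply: ge0_ler_powR; rewrite ?nnegrE ?(ltW p0)//.
  rewrite -uf; have [u0|u0] := leP (u x) 0; last exact: lexx.
  by rewrite normr0.
have -> : f = (fun x => Num.max (f x) 0 + -1 * Num.max (- f x) 0).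
  apply/funext => x; have [f0|f0] := leP (f x) 0.
    by rewrite max_l ?oppr_ge0// mulN1r opprK add0r.
  by rewrite max_r ?oppr_le0 ?ltW// mulr0 addr0.
apply: approximable_add; first exact: h.
apply: approximable_scale; apply: h => [|x]; last by rewrite normrN.
exact: measurableT_comp.
Qed.

End density.

(** * Monomials and moments *)

Section monomials.
Context {R : realType} {d : nat}.
Local Notation E := 'rV[R]_d.

(** All exponents of total degree at most N are among these; a finite type that
is larger than needed avoids subtypes. *)
Definition multi N := {ffun 'I_d -> 'I_N.+1}.

Definition expo N (al : multi N) : 'I_d -> nat := fun i => al i.

(** The coefficients are recovered from the values on a grid by inverting one
Vandermonde matrix for each variable. *)
Lemma monomials_independent N (c : multi N -> R) (w : E) (r : R) : 0 < r ->
  (forall x : E, (forall i, `|x ord0 i - w ord0 i| < r) ->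
    \sum_al c al * monomial (expo al) x = 0) ->
  forall al, c al = 0.
Proof.
move=> r0 c0 al.
pose node i (l : 'I_N.+1) : R := w ord0 i + r * (l%:R / N.+1%:R).
pose V i := Vandermonde N.+1 (\row_l node i l).
have VE i j l : V i j l = node i l ^+ j by rewrite !mxE.
have uV i : V i \in unitmx.
  rewrite unitmxE det_Vandermonde unitfE; apply/prodf_neq0 => j _.
  apply/prodf_neq0 => l jl; rewrite !mxE /node opprD addrACA subrr add0r -mulrBr.
  rewrite mulf_neq0 ?gt_eqF// subr_gt0 ltr_pM2r ?invr_gt0// ltr_nat//.
pose W i := invmx (V i).
have VW i (j j' : 'I_N.+1) : \sum_l node i l ^+ j' * W i l j = (j' == j)%:R.
  have := mulmxV (uV i) => /matrixP/(_ j' j); rewrite !mxE => <-.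
  by apply: eq_bigr => l _; rewrite VE.
pose pt (la : multi N) : E := \row_i node i (la i).
have ptP la i : `|pt la ord0 i - w ord0 i| < r.
  rewrite mxE /node addrC addKr ger0_norm ?mulr_ge0 ?divr_ge0 ?(ltW r0)//.
  by rewrite gtr_pMr// ltr_pdivrMr// mul1r ltr_nat.
have zero : \sum_(la : multi N) (\prod_i W i (la i) (al i)) *
    (\sum_be c be * monomial (expo be) (pt la)) = 0.
  by apply: big1 => la _; rewrite c0 ?mulr0// => i; exact: ptP.
rewrite -zero.
under eq_bigr do rewrite mulr_sumr.
rewrite exchange_big /= (bigD1 al)//= [X in _ + X]big1 ?addr0; last first.
  move=> be beal; under eq_bigr do rewrite mulrCA.
  rewrite -mulr_sumr; apply/eqP; rewrite mulf_eq0; apply/orP; right.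
  have -> : \sum_(la : multi N) (\prod_i W i (la i) (al i)) * monomial (expo be) (pt la) =
     \sum_(la : multi N) \prod_i (node i (la i) ^+ be i * W i (la i) (al i)).
    apply: eq_bigr => la _; rewrite mulrC -big_split /=; apply: eq_bigr => i _.
    by rewrite mxE.
  rewrite -(bigA_distr_bigA (fun i l => node i l ^+ be i * W i l (al i))).
  under eq_bigr do rewrite VW.
  apply/prodf_eq0; have /eqP/ffunP := beal.
  move=> h; have [i /eqP bi] : exists i, be i <> al i.
    by apply/existsNP => h'; exact: h.
  by exists i => //; rewrite (negbTE bi).
under eq_bigr do rewrite mulrCA.
rewrite -mulr_sumr.
have -> : \sum_(la : multi N) (\prod_i W i (la i) (al i)) * monomial (expo al) (pt la) =
     \sum_(la : multi N) \prod_i (node i (la i) ^+ al i * W i (la i) (al i)).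
  apply: eq_bigr => la _; rewrite mulrC -big_split /=; apply: eq_bigr => i _.
  by rewrite mxE.
rewrite -(bigA_distr_bigA (fun i l => node i l ^+ al i * W i l (al i))).
under eq_bigr do rewrite VW eqxx.
by rewrite big1_eq mulr1.
Qed.

End monomials.

Section moments.
Context {R : realType} {d : nat}.
Local Notation E := 'rV[R]_d.
Local Notation leb := (@lebesgue_rV R d).
Variables (Ap : {fset E}) (k : E -> R).
Hypothesis k0 : forall a, a \in Ap -> 0 <= k a.
Hypothesis dim0 : 0 < dunkl_dim Ap k.
Local Notation v := (dunkl_weight Ap k).
Local Notation D := (dunkl_dim Ap k).
Implicit Types (f g : E -> R) (m : 'I_d -> nat).

Definition degree m : nat := \sum_i m i.

Lemma norm_monomial m (x : E) : `|monomial m x| <= (1 + `|x|) ^+ degree m.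
Proof.
rewrite normr_prod /degree.
suff : 0 <= \prod_i `|x ord0 i ^+ m i| <= (1 + `|x|) ^+ (\sum_i m i) by case/andP.
elim/big_rec2 : _ => [|i n p _ /andP[h0 h]]; first by rewrite expr0 ler01 lexx.
rewrite mulr_ge0//= exprD; apply: ler_pM => //.
by rewrite normrX lerXn2r ?nnegrE ?addr_ge0// (le_trans (norm_coord_le x i))// lerDr.
Qed.

Lemma measurable_monomial m : measurable_fun setT (@monomial R d m).
Proof.
by apply: measurable_prod => i _; apply: measurable_funX; exact: measurable_coord.
Qed.

Definition moment m f : R := \int[leb]_x (monomial m x * f x * v x).

Definition integrable_moment m f := leb.-integrable setT
  (EFin \o (fun x => monomial m x * f x * v x)).

Lemma measurable_decay (t : R) : measurable_fun [set: E] (fun x => (1 + `|x|) `^ (- t)).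
Proof.
apply: (measurableT_comp (measurable_powR (- t))).
by apply: measurable_funD => //; exact: measurable_norm_rV.
Qed.

Lemma integrable_decay (t : R) : D < t ->
  leb.-integrable setT (EFin \o (fun x : E => (1 + `|x|) `^ (- t) * v x)).
Proof.
move=> Dt; apply/integrableP; split.
  apply/measurable_EFinP; apply: measurable_funM; first exact: measurable_decay.
  exact: measurable_dunkl_weight.
have := integral_enorm_weight_lty k0 (s := 0) (t := t).
rewrite oppr_lt0 add0r => /(_ dim0 Dt); apply: le_lt_trans.
apply: ge0_le_integral.
- exact: measurableT.
- by move=> x _; rewrite abse_ge0.
- apply: measurableT_comp => //; apply/measurable_EFinP.
  apply: measurable_funM; first exact: measurable_decay.
  exact: measurable_dunkl_weight.
- apply/measurable_EFinP; apply: measurable_funM; last exact: measurable_decay.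
  by apply: measurable_funM; [exact: measurable_enorm_powR|exact: measurable_dunkl_weight].
move=> x _; rewrite /= lee_fin powRr0 mul1r mulrC ger0_norm//.
by rewrite mulr_ge0 ?powR_ge0 ?dunkl_weight_ge0.
Qed.

Lemma integrable_moment_decay m f (C t : R) : measurable_fun setT f ->
  D + (degree m)%:R < t ->
  (forall x, `|f x| <= C * (1 + `|x|) `^ (- t)) -> integrable_moment m f.
Proof.
move=> mf Dt fC.
have iC : leb.-integrable setT (EFin \o (fun x : E =>
    C * ((1 + `|x|) `^ (- (t - (degree m)%:R)) * v x))).
  have -> : EFin \o (fun x : E => C * ((1 + `|x|) `^ (- (t - (degree m)%:R)) * v x)) =
      (fun x => C%:E * (EFin \o (fun x : E =>
        ((1 + `|x|) `^ (- (t - (degree m)%:R)) * v x)%R)) x)%E.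
    by apply/funext => x /=; rewrite EFinM.
  by apply: integrableZl => //; apply: integrable_decay; rewrite ltrBrDr.
apply: le_integrable iC => //.
  apply/measurable_EFinP; apply: measurable_funM; last exact: measurable_dunkl_weight.
  by apply: measurable_funM => //; exact: measurable_monomial.
move=> x _; rewrite /= lee_fin !normrM mulrA ler_wpM2r//.
have x1 : 0 < 1 + `|x| by rewrite ltr_pwDl.
have C0 : 0 <= C.
  by have := le_trans (normr_ge0 _) (fC x); rewrite pmulr_lge0// powR_gt0.
rewrite (ger0_norm C0) (ger0_norm (powR_ge0 _ _)).
apply: le_trans (ler_pM _ _ (norm_monomial m x) (fC x)) _ => //.
rewrite mulrCA ler_wpM2l// opprB -powR_mulrn ?(ltW x1)//.
by rewrite -powRD// (gt_eqF x1) implybT.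
Qed.

Lemma test_fun_decay f (t : R) s : test_fun f -> exists2 C, 0 <= C &
  forall x, `|iter_partial s f x| <= C * (1 + `|x|) `^ (- t).
Proof.
move=> tf; have [C C0 hC] := test_fun_bounded s tf; have [_ [K fK]] := tf.
exists (C * (1 + `|K|) `^ `|t|) => [|x]; first by rewrite mulr_ge0 ?powR_ge0.
have [xK|xK] := leP `|x| K; last first.
  by rewrite (iter_partial_vanish s fK)// normr0 !mulr_ge0 ?powR_ge0.
rewrite -mulrA; apply: le_trans (hC x) _.
rewrite ler_peMr// powRN ler_pdivlMr ?powR_gt0 ?ltr_pwDl// mul1r.
apply: le_trans (ler_powR _ (ler_norm t)) _; first by rewrite lerDl.
apply: ge0_ler_powR; rewrite ?nnegrE ?addr_ge0//.
by rewrite lerD2l (le_trans xK)// ler_norm.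
Qed.

Lemma integrable_moment_test m f : test_fun f -> integrable_moment m f.
Proof.
move=> tf; have [C C0 hC] := test_fun_decay (D + (degree m)%:R + 1) [::] tf.
apply: (integrable_moment_decay (C := C) (t := D + (degree m)%:R + 1)) => //.
- exact: measurable_test_fun tf.
- by rewrite ltrDl.
Qed.

Lemma momentD m f g : integrable_moment m f -> integrable_moment m g ->
  moment m (fun x => f x + g x) = moment m f + moment m g.
Proof.
move=> mf mg; rewrite /moment -RintegralD//.
by apply: eq_Rintegral => x _; rewrite mulrDr mulrDl.
Qed.

Lemma momentZ m (c : R) f : integrable_moment m f ->
  moment m (fun x => c * f x) = c * moment m f.
Proof.
move=> mf; rewrite /moment -RintegralZl//.
by apply: eq_Rintegral => x _; rewrite mulrCA !mulrA.
Qed.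

Lemma moment_sum m (I : Type) (r : seq I) (F : I -> E -> R) :
  (forall i, test_fun (F i)) ->
  moment m (fun x => \sum_(i <- r) F i x) = \sum_(i <- r) moment m (F i).
Proof.
move=> tF; elim: r => [|i r ih].
  rewrite big_nil /moment (_ : (fun x => _) = cst 0).
    by rewrite Rintegral_cst// mul0r.
  by apply/funext => x; rewrite big_nil mulr0 mul0r.
rewrite (_ : (fun x => \sum_(j <- i :: r) F j x) =
          (fun x => F i x + \sum_(j <- r) F j x)).
  rewrite big_cons momentD ?ih//; apply: integrable_moment_test => //.
  exact: test_fun_sum.
by apply/funext => x; rewrite big_cons.
Qed.

End moments.

(** * Finite moment problems in a cube *)

Section moment_problem.
Context {R : realType} {d : nat}.
Local Notation E := 'rV[R]_d.
Local Notation leb := (@lebesgue_rV R d).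
Variables (Ap : {fset E}) (k : E -> R).
Hypothesis k0 : forall a, a \in Ap -> 0 <= k a.
Hypothesis dim0 : 0 < dunkl_dim Ap k.
Local Notation v := (dunkl_weight Ap k).
Local Notation M := (moment Ap k).

Variables (w : E) (r : R).
Hypothesis r0 : 0 < r.
Hypothesis v_gt0 : forall x : E, (forall i, `|x ord0 i - w ord0 i| < r) -> 0 < v x.

Let Q (x : E) := forall i, `|x ord0 i - w ord0 i| < r.

(* TB m is the monomial of exponent m times the bump chi on the cube Q. *)
Let TB (m : 'I_d -> nat) : E -> R :=
  tensor (fun i t => t ^+ m i * tbump (w ord0 i - r) (w ord0 i + r) 1 t).

Let chi : E -> R := TB (fun=> 0%N).

Let TBE m x : TB m x = monomial m x * chi x.
Proof.
rewrite /chi /TB /tensor /monomial -big_split /=; apply: eq_bigr => i _.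
by rewrite expr0 mul1r.
Qed.

Let TB_out m x : ~ Q x -> TB m x = 0.
Proof.
move=> /existsNP[i /negP xi]; apply/eqP/prodf_eq0; exists i => //.
by rewrite tbump_out ?mulr0// -ltr_distl.
Qed.

Let chi_gt0 x : Q x -> 0 < chi x.
Proof.
move=> Qx; apply: prodr_gt0 => i _; rewrite expr0 mul1r tbump_gt0//.
by rewrite -ltr_distl.
Qed.

Let chi_ge0 x : 0 <= chi x.
Proof. by apply: prodr_ge0 => i _; rewrite expr0 mul1r tbump_ge0. Qed.

Let bounded_Q x : Q x -> `|x| <= `|w| + r.
Proof.
move=> Qx; apply/norm_rV_le => [|i]; first by rewrite addr_ge0// ltW.
rewrite -[x ord0 i](subrK (w ord0 i)) addrC; apply: le_trans (ler_normD _ _) _.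
by rewrite lerD ?norm_coord_le// ltW.
Qed.

Let test_TB m : test_fun (TB m).
Proof.
split.
  apply: smooth_tensor => i; apply: smooth1_mul; first exact: smooth1_exprn.
  exact: smooth1_tbump.
exists (`|w| + r) => x xK; apply: TB_out => /bounded_Q.
by rewrite leNgt xK.
Qed.

Let monoD m m' x : monomial m x * TB m' x = TB (fun i => m i + m' i)%N x.
Proof.
rewrite !TBE mulrA; congr (_ * _); rewrite /monomial -big_split /=.
by apply: eq_bigr => i _; rewrite exprD.
Qed.

(* A zero integral makes g v vanish almost everywhere; a nonempty open set has
positive measure, so continuity removes the exceptional set. *)
Let moment0_eq0 (g : E -> R) : test_fun g -> (forall x, 0 <= g x) ->
  M (fun=> 0%N) g = 0 -> forall x, Q x -> g x = 0.
Proof.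
move=> tg g0 Mg x0 Qx0; apply/eqP; rewrite eq_le g0 andbT leNgt; apply/negP => gx0.
have ig := integrable_moment_test k0 dim0 (fun=> 0%N) tg.
have mono0 (x : E) : monomial (fun=> 0%N) x = 1 :> R.
  by rewrite /monomial big1// => i _; rewrite expr0.
have mg : measurable_fun setT (fun x => g x * v x).
  by apply: measurable_funM; [exact: measurable_test_fun tg|exact: measurable_dunkl_weight].
have I0 : (\int[leb]_x `|(g x * v x)%:E| = 0)%E.
  have -> : (\int[leb]_x `|(g x * v x)%:E| =
             \int[leb]_x (EFin \o (fun x => monomial (fun=> 0%N) x * g x * v x)%R) x)%E.
    apply: eq_integral => x _ /=.
    by rewrite mono0 mul1r ger0_norm// mulr_ge0 ?dunkl_weight_ge0.
  rewrite -[LHS]fineK; last exact: integrable_fin_num.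
  by rewrite -[fine _]/(M (fun=> 0%N) g) Mg.
have mgE : measurable_fun setT (fun x => (g x * v x)%:E) by exact/measurable_EFinP.
have [Z [mZ Z0 hZ]] := (ae_eq_integral_abs leb measurableT mgE).1 I0.
have cg := @smooth_continuous _ _ g [::] tg.1.
have near_g : \forall x \near x0, 0 < g x.
  by have := cg x0; move/cvgr_gt; apply.
have near_Q : \forall x \near x0, ball w r x.
  apply: open_nbhs_nbhs; split; first exact: ball_open.
  by apply/ball_rVP => // i; rewrite distrC.
have /nbhs_ballP[e /= e0 he] : \forall x \near x0, ball w r x /\ 0 < g x.
  by near=> x; split; near: x.
have : (0 < leb (open_box (fun i => (x0 ord0 i - e)%R) (fun i => (x0 ord0 i + e)%R)))%E.
  rewrite lebesgue_open_box => [|i]; last by rewrite lerD2l ge0_cp// ltW.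
  by rewrite lte_fin prodr_gt0// => i _; rewrite opprD opprK addrACA subrr add0r addr_gt0.
apply/negP; rewrite -leNgt -Z0; apply: le_measure; rewrite ?inE//.
  exact: measurable_open_box.
move=> x xB; have [Qx gx] : ball w r x /\ 0 < g x.
  by apply: he; apply/ball_rVP => // i; rewrite distrC ltr_distl; exact: xB.
apply: hZ => /= /(_ I) /eqP; rewrite eqe mulf_eq0 (gt_eqF gx)/= gt_eqF//.
by apply: v_gt0 => i; move/ball_rVP : Qx => /(_ r0 i); rewrite distrC.
Unshelve. all: by end_near. Qed.

(** The solution is sought as a polynomial times a bump chi. The matrix of the
linear system is the Gram matrix of the monomials for the density chi v, and it
is invertible because a polynomial that vanishes on a cube is zero. *)
Lemma moment_problem N (T : @multi d N -> R) : exists psi : E -> R,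
  [/\ test_fun psi, (forall x, ~ Q x -> psi x = 0) &
      forall al, M (expo al) psi = T al].
Proof.
pose n := #|{: @multi d N}|.
pose al_ (i : 'I_n) : @multi d N := enum_val i.
pose G : 'M[R]_n := \matrix_(i, j) M (expo (al_ i)) (TB (expo (al_ j))).
have uG : G \in unitmx.
  rewrite -row_free_unit; apply: inj_row_free => z zG.
  pose e_ i := expo (al_ i).
  pose F i j (x : E) := z ord0 i * z ord0 j * TB (fun l => e_ i l + e_ j l)%N x.
  have tF i j : test_fun (F i j) by exact: test_fun_scale.
  have tFi i : test_fun (fun x => \sum_j F i j x) by exact: test_fun_sum.
  pose g x := \sum_i \sum_j F i j x.
  have tg : test_fun g by exact: test_fun_sum.
  pose P x := \sum_i z ord0 i * monomial (e_ i) x.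
  have gE x : g x = P x ^+ 2 * chi x.
    rewrite expr2 /P mulr_suml mulr_suml; apply: eq_bigr => i _.
    rewrite mulr_sumr mulr_suml; apply: eq_bigr => j _.
    by rewrite /F -monoD TBE; ring.
  have Mg : M (fun=> 0%N) g = 0.
    rewrite (moment_sum k0 dim0)//; under eq_bigr do rewrite (moment_sum k0 dim0)//.
    have Fm i j : M (fun=> 0%N) (F i j) = z ord0 j * (z ord0 i * G i j).
      rewrite momentZ; last exact: integrable_moment_test.
      rewrite mulrCA mulrA; congr (_ * _); rewrite mxE; apply: eq_Rintegral => x _.
      rewrite -monoD mulrA; congr (_ * _ * _).
      by rewrite /monomial [X in X * _]big1 ?mul1r// => l _; rewrite expr0.
    under eq_bigr do under eq_bigr do rewrite Fm.
    rewrite exchange_big /= big1// => j _; rewrite -mulr_sumr.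
    have := zG => /matrixP/(_ ord0 j); rewrite !mxE => ->; exact: mulr0.
  have P0 x : Q x -> P x = 0.
    move=> Qx; have g0 y : 0 <= g y by rewrite gE mulr_ge0 ?sqr_ge0.
    have := moment0_eq0 tg g0 Mg Qx; rewrite gE => /eqP.
    by rewrite mulf_eq0 sqrf_eq0 (gt_eqF (chi_gt0 Qx)) orbF => /eqP.
  have zc : forall al, z ord0 (enum_rank al) = 0.
    apply: (monomials_independent (w := w) r0) => x Qx.
    rewrite -[RHS](P0 x Qx) /P.
    rewrite (reindex al_) /=; last exact/onW_bij/enum_val_bij.
    by apply: eq_bigr => i _; rewrite /al_ enum_valK.
  by apply/rowP => i; rewrite mxE -(enum_valK i) zc.
pose y := invmx G *m (\col_i T (al_ i)).
exists (fun x => \sum_j y j ord0 * TB (expo (al_ j)) x).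
have tj j : test_fun (fun x => y j ord0 * TB (expo (al_ j)) x).
  exact: test_fun_scale.
split.
- exact: test_fun_sum.
- by move=> x Qx; rewrite big1// => j _; rewrite TB_out// mulr0.
move=> al; rewrite (moment_sum k0 dim0)//.
have GE : G *m y = \col_i T (al_ i) by rewrite /y mulmxA mulmxV// mul1mx.
have := congr1 (fun B : 'cV_n => B (enum_rank al) ord0) GE.
rewrite !mxE /al_ enum_rankK => <-; apply: eq_bigr => j _.
rewrite momentZ; last exact: integrable_moment_test.
by rewrite [G _ _]mxE /al_ enum_rankK mulrC.
Qed.

End moment_problem.

(** * Correctors supported far from the origin *)

Section corrector.
Context {R : realType} {d : nat}.
Local Notation E := 'rV[R]_d.
Local Notation leb := (@lebesgue_rV R d).
Variables (Ap : {fset E}) (k : E -> R) (u : E).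
Hypothesis k0 : forall a, a \in Ap -> 0 <= k a.
Hypothesis d0 : (0 < d)%N.
Hypothesis u0 : forall a, a \in Ap -> dot u a != 0.
Local Notation v := (dunkl_weight Ap k).
Local Notation M := (moment Ap k).
Local Notation D := (dunkl_dim Ap k).

Lemma dunkl_dim_gt0 : 0 < D.
Proof. by rewrite dunkl_dimE ltr_pwDl ?ltr0n// weight_degree_ge0. Qed.
Let dim0 := dunkl_dim_gt0.

(** The hyperplanes orthogonal to the roots miss the vector u, hence a
neighbourhood of it. When u is zero there is no root, and any nonzero vector
serves, the origin being excluded in order to push dilates to infinity. *)
Lemma good_cube : exists (w : E) (r rho : R), [/\ 0 < r, 0 < rho &
  forall x : E, (forall i, `|x ord0 i - w ord0 i| < r) -> 0 < v x /\ rho <= `|x|].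
Proof.
have [w w0 wA] : exists2 w : E, w != 0 & forall a, a \in Ap -> dot a w != 0.
  have [uz|un0] := eqVneq u 0; last first.
    exists u => // a /u0; rewrite /dot.
    by under eq_bigr do rewrite mulrC.
  exists (const_mx 1).
    apply/eqP => /rowP/(_ (Ordinal d0)); rewrite !mxE => /eqP.
    by rewrite oner_eq0.
  move=> a /u0; rewrite uz /dot big1 ?eqxx// => i _.
  by rewrite mxE mul0r.
have near_dot a : a \in Ap -> \forall x \near w, dot a x != 0.
  move=> aA; have aw := wA a aA.
  pose C := \sum_i `|a ord0 i| + 1.
  have C0 : 0 < C by rewrite ltr_wpDl// sumr_ge0.
  apply/nbhs_ballP; exists (`|dot a w| / C) => [|x] /=.
    by rewrite divr_gt0// normr_gt0.
  rewrite -ball_normE /= ltr_pdivlMr// mulrC => wx.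
  apply/eqP => ax0; move: wx; apply/negP; rewrite -leNgt.
  have -> : dot a w = dot a (w - x).
    rewrite -[LHS]subr0 -ax0 /dot -sumrB; apply: eq_bigr => i _.
    by rewrite !mxE mulrBr.
  apply: le_trans (dot_le _ _) _.
  by rewrite ler_wpM2r// /C lerDl.
have near_all : \forall x \near w, forall a, a \in Ap -> dot a x != 0.
  have h (s : seq E) : {subset s <= Ap} -> \forall x \near w, forall a, a \in s -> dot a x != 0.
    elim: s => [|a s ih] sA; first by near=> x => a; rewrite in_nil.
    have ha := near_dot a (sA a (mem_head a s)).
    have {}ih := ih (fun b bs => sA b (mem_behead (s := a :: s) bs)).
    by apply: filterS2 ha ih => x hx hs b; rewrite inE => /predU1P[->//|/hs].
  exact: h.
have near_rho : \forall x \near w, `|w| / 2 <= `|x|.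
  apply/nbhs_ballP; exists (`|w| / 2) => [|x] /=; first by rewrite divr_gt0// normr_gt0.
  rewrite -ball_normE /= => wx; have := ler_normD (w - x) x; rewrite subrK; lra.
have /nbhs_ballP[r /= r0 hr] : \forall x \near w,
    (forall a, a \in Ap -> dot a x != 0) /\ `|w| / 2 <= `|x|.
  by near=> x; split; near: x.
exists w, r, (`|w| / 2); split => //; first by rewrite divr_gt0// normr_gt0.
move=> x xw; have [hA hx] : (forall a, a \in Ap -> dot a x != 0) /\ `|w| / 2 <= `|x|.
  by apply: hr; apply/ball_rVP => // i; rewrite distrC.
split => //; rewrite /dunkl_weight big_seq prodr_gt0// => a aA.
by rewrite powR_gt0// normr_gt0 hA.
Unshelve. all: by end_near. Qed.

Lemma monomialZ m (c : R) (x : E) : monomial m (c *: x) = c ^+ degree m * monomial m x.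
Proof.
rewrite /monomial /degree -prodrXr -big_split /=; apply: eq_bigr => i _.
by rewrite mxE exprMn.
Qed.

(** By homogeneity of the weight, dilation by e multiplies a moment of degree n by
e^(- D - n); the normalization fixes the moments of degree N. *)
Lemma moment_dilate m (psi : E -> R) (e : R) (N : nat) : 0 < e -> test_fun psi ->
  e ^+ degree m * M m (fun x => e `^ (D + N%:R) * psi (e *: x)) = e ^+ N * M m psi.
Proof.
move=> e0 tp; have mp := measurable_test_fun tp.
have mF : measurable_fun setT (fun x : E => monomial m x * psi x * v x).
  apply: measurable_funM; last exact: measurable_dunkl_weight.
  by apply: measurable_funM => //; exact: measurable_monomial.
have eD : e `^ (D + N%:R) = e ^+ d * e `^ weight_degree Ap k * e ^+ N.
  rewrite dunkl_dimE !powRD ?(gt_eqF e0) ?implybT//.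
  by rewrite !powR_mulrn ?(ltW e0).
have key (x : E) : monomial m x * (e `^ (D + N%:R) * psi (e *: x)) * v x =
  e ^+ d * e ^+ N / e ^+ degree m * (monomial m (e *: x) * psi (e *: x) * v (e *: x)).
  rewrite monomialZ (dunkl_weightZ k0)// eD.
  rewrite [RHS](_ : _ = (e ^+ degree m / e ^+ degree m) *
      (e ^+ d * e ^+ N * monomial m x * psi (e *: x) * (e `^ weight_degree Ap k * v x))).
    by rewrite mulfV ?gt_eqF ?exprn_gt0// mul1r; ring.
  by ring.
have iF := integrable_moment_test k0 dim0 m tp.
rewrite /moment; under eq_Rintegral do rewrite key.
pose c := e ^+ d * e ^+ N / e ^+ degree m.
rewrite (Rintegral_scale (f := fun y => c * (monomial m y * psi y * v y)) e0); last first.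
  exact: measurable_funM.
rewrite RintegralZl//.
have em : e ^+ degree m != 0 by rewrite gt_eqF ?exprn_gt0.
have ed : e ^+ d != 0 by rewrite gt_eqF ?exprn_gt0.
by rewrite /c; field; rewrite em ed.
Qed.

Lemma small_scale (C s eta : R) : 0 < s -> 0 < eta ->
  \forall e \near (0 : R)^'+, C * e `^ s < eta.
Proof.
move=> s0 eta0.
have h : (fun e : R => C * e `^ s) @ (0 : R)^'+ --> C * 0.
  exact: (cvgM (cvg_cst C) (powR_cvg0 s0)).
by move: h; rewrite mulr0 => /cvgr_lt; apply.
Qed.

(** Take a solution psi of a finite moment problem and the dilate
e^(D + N) psi(e x) for small e. Its moments of degree N are those of psi, while
it lives at distance of order 1 / e: weights of order q < D cost e^(-q) against
e^D, and a weight of order N costs e^(-N) against e^(D + N). *)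
Lemma corrector (N : nat) (t : ('I_d -> nat) -> R) (eta q : R) :
  0 < eta -> 0 <= q -> q < D -> exists h : E -> R,
  [/\ test_fun h /\ (forall x, `|x| < N.+1%:R -> h x = 0),
      forall x, `|h x| <= eta * (1 + `|x|) `^ (- q),
      forall s, (size s <= N)%N ->
        forall x, (1 + `|x|) ^+ N * `|iter_partial s h x| <= eta &
      (forall m, (degree m < N)%N -> M m h = 0) /\
      (forall m, degree m = N -> M m h = t m)].
Proof.
move=> eta0 q0 qD.
have [w [r [rho [r0 rho0 hQ]]]] := good_cube.
have v0 (x : E) : (forall i, `|x ord0 i - w ord0 i| < r) -> 0 < v x by move=> /hQ[].
pose T (al : @multi d N) := if degree (expo al) == N then t (expo al) else 0.
have [psi [tpsi psi_out psiT]] := moment_problem k0 dim0 r0 v0 T.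
have psim m : (degree m <= N)%N -> M m psi = if degree m == N then t m else 0.
  move=> mN; have mi i : (m i < N.+1)%N.
    by rewrite ltnS (leq_trans _ mN)// /degree (bigD1 i)//= leq_addr.
  have mE : expo [ffun i => Ordinal (mi i)] = m.
    by apply/funext => i; rewrite /expo ffunE.
  by have := psiT [ffun i => Ordinal (mi i)]; rewrite /T mE.
have [_ [K psiK]] := tpsi.
pose L := 1 + `|K|.
have L0 : 0 < L by rewrite ltr_pwDl.
have psiL s (x : E) : L < `|x| -> iter_partial s psi x = 0.
  move=> Lx; apply: iter_partial_vanish psiK _ _; apply: le_lt_trans Lx.
  by rewrite (le_trans (ler_norm K))// lerDr.
have /choice[Cs hCs] : forall s, exists C, 0 <= C /\ forall x : E, `|iter_partial s psi x| <= C.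
  by move=> s; have [C C0 hC] := test_fun_bounded s tpsi; exists C.
pose C := \sum_(s : N.-bseq 'I_d) Cs s.
have hC s x : (size s <= N)%N -> `|iter_partial s psi x| <= C.
  move=> sN; apply: le_trans ((hCs s).2 x) _.
  rewrite /C (bigD1 (Bseq sN))//= lerDl sumr_ge0// => s' _.
  exact: (hCs s').1.
have C0 : 0 <= C by apply: sumr_ge0 => s _; exact: (hCs s).1.
have near1 : \forall e \near (0 : R)^'+, (1 + L) ^+ N * C * e `^ D < eta by exact: small_scale.
have near2 : \forall e \near (0 : R)^'+, (1 + L) `^ q * C * e `^ (D - q) < eta.
  by apply: small_scale => //; rewrite subr_gt0.
have [e [e0 e1 eN eC eq]] : exists e : R, [/\ 0 < e, e <= 1, e * N.+1%:R < rho,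
    (1 + L) ^+ N * C * e `^ D < eta & (1 + L) `^ q * C * e `^ (D - q) < eta].
  have near3 : \forall e \near (0 : R)^'+, e < rho / N.+1%:R.
    by apply: nbhs_right_lt; rewrite divr_gt0.
  have near4 : \forall e \near (0 : R)^'+, e < 1 by exact: nbhs_right_lt.
  have near5 : \forall e \near (0 : R)^'+, 0 < e by exact: nbhs_right_gt.
  near (0 : R)^'+ => e; exists e; split; [near: e|apply: ltW; near: e| |near: e|near: e] => //.
  by rewrite -ltr_pdivlMr//; near: e.
pose c := e `^ (D + N%:R).
have c0 : 0 <= c by exact: powR_ge0.
have en0 : e != 0 by rewrite gt_eqF.
have sdil : smooth (fun x : E => psi (e *: x)) by apply: smooth_dilate => //; exact: tpsi.1.
have hE s (x : E) : iter_partial s (fun x : E => c * psi (e *: x)) x =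
    c * (e ^+ size s * iter_partial s psi (e *: x)).
  by rewrite iter_partial_scale// iter_partial_dilate//; exact: tpsi.1.
(* on the support of the dilated function, polynomial weights cost only powers
of 1 / e *)
have grow (x : E) : `|e *: x| <= L -> 1 + `|x| <= (1 + L) / e.
  rewrite normrZ gtr0_norm// => exL; rewrite ler_pdivlMr// mulrDl mul1r.
  by rewrite lerD// mulrC.
have cE : c = e `^ D * e ^+ N.
  by rewrite /c powRD ?en0 ?implybT// powR_mulrn// ltW.
have hs s (x : E) : (size s <= N)%N ->
    `|iter_partial s (fun x : E => c * psi (e *: x)) x| <= c * C.
  move=> sN; rewrite hE normrM (ger0_norm c0) ler_wpM2l// normrM.
  rewrite -[leRHS]mul1r ler_pM ?hC// ger0_norm ?exprn_ge0 ?(ltW e0)//.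
  by rewrite exprn_ile1// ltW.
exists (fun x => c * psi (e *: x)); split.
- split.
    split; first exact: smooth_scale.
    exists (L / e) => x xL; rewrite (psiK (e *: x)) ?mulr0// normrZ gtr0_norm//.
    move: xL; rewrite ltr_pdivrMr// mulrC; apply: le_lt_trans.
    by rewrite (le_trans (ler_norm K))// lerDr.
  move=> x xN; rewrite psi_out ?mulr0// => /hQ[_].
  apply/negP; rewrite -ltNge; apply: lt_trans eN.
  by rewrite normrZ gtr0_norm// ltr_pM2l.
- move=> x; have [xL|xL] := leP `|e *: x| L; last first.
    have /= -> := psiL [::] _ xL.
    by rewrite mulr0 normr0 mulr_ge0 ?powR_ge0// ltW.
  have x1 : 0 < 1 + `|x| by rewrite ltr_pwDl.
  rewrite powRN ler_pdivlMr ?powR_gt0//.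
  apply: (@le_trans _ _ (c * C * ((1 + L) / e) `^ q)).
    apply: ler_pM; rewrite ?powR_ge0//; first exact: (hs [::]).
    by apply: ge0_ler_powR; rewrite ?nnegrE ?(ltW x1) ?grow ?divr_ge0 ?addr_ge0 ?(ltW L0) ?(ltW e0).
  apply: le_trans (ltW eq).
  rewrite powRM ?addr_ge0 ?(ltW L0) ?invr_ge0 ?(ltW e0)// cE.
  have -> : e^-1 `^ q = e `^ (- q).
    by rewrite -powR_inv1 ?(ltW e0)// -powRrM mulN1r.
  rewrite powRD ?en0 ?implybT//.
  rewrite [leLHS](_ : _ = (1 + L) `^ q * C * (e `^ D * e `^ (- q)) * e ^+ N); last by ring.
  by rewrite ler_piMr ?exprn_ile1 ?(ltW e0)// !mulr_ge0 ?powR_ge0.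
- move=> s sN x; have [xL|xL] := leP `|e *: x| L; last first.
    by rewrite hE psiL// !mulr0 normr0 mulr0 ltW.
  apply: (@le_trans _ _ (((1 + L) / e) ^+ N * (c * C))).
    apply: ler_pM; rewrite ?exprn_ge0 ?addr_ge0//; last exact: hs.
    have eL : 0 <= (1 + L) / e by rewrite divr_ge0 ?addr_ge0 ?(ltW L0) ?(ltW e0).
    by rewrite lerXn2r ?nnegrE ?addr_ge0// grow.
  apply: le_trans (ltW eC); rewrite cE expr_div_n.
  rewrite [leLHS](_ : _ = (1 + L) ^+ N * C * e `^ D * (e ^+ N / e ^+ N)); last by ring.
  by rewrite mulfV ?mulr1// expf_neq0.
split=> m mN.
- have := moment_dilate m N e0 tpsi; rewrite psim ?(ltnW mN)// ltn_eqF// mulr0.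
  by move=> /eqP; rewrite mulf_eq0 expf_eq0 (negbTE en0) andbF => /eqP.
- have := moment_dilate m N e0 tpsi; rewrite psim ?mN// eqxx.
  by apply: mulfI; rewrite expf_neq0.
Unshelve. all: by end_near. Qed.

End corrector.

(** * Small Schwartz functions with prescribed moments *)

Section moment_matching.
Context {R : realType} {d : nat}.
Local Notation E := 'rV[R]_d.
Local Notation leb := (@lebesgue_rV R d).
Variables (Ap : {fset E}) (k : E -> R) (u : E).
Hypothesis k0 : forall a, a \in Ap -> 0 <= k a.
Hypothesis d0 : (0 < d)%N.
Hypothesis u0 : forall a, a \in Ap -> dot u a != 0.
Local Notation v := (dunkl_weight Ap k).
Local Notation M := (moment Ap k).
Local Notation D := (dunkl_dim Ap k).

Let dim0 : 0 < D := dunkl_dim_gt0 k0 d0.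

Lemma sum_halves (n : nat) : \sum_(0 <= j < n) (2^-1 : R) ^+ j.+1 = 1 - 2^-1 ^+ n.
Proof.
elim: n => [|n ih]; first by rewrite big_geq// expr0 subrr.
rewrite big_nat_recr//= ih exprS; lra.
Qed.

Lemma sum_halves_le1 (m n : nat) : \sum_(m <= j < n) (2^-1 : R) ^+ j.+1 <= 1.
Proof.
have [mn|nm] := leqP m n; last by rewrite big_geq// ltnW.
have := sum_halves n; rewrite (big_cat_nat (n := m))//= => h.
have h1 : 0 <= \sum_(0 <= j < m) (2^-1 : R) ^+ j.+1 by apply: sumr_ge0 => j _; rewrite exprn_ge0.
have h2 : 0 <= (2^-1 : R) ^+ n by rewrite exprn_ge0.
lra.
Qed.

(** The term of index N repairs the moments of degree N of the partial sum and
leaves the lower ones unchanged, so each moment is eventually constant along the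
partial sums. The terms vanish on balls of increasing radius: the sum is locally
finite, and every seminorm involves finitely many uncontrolled terms followed by
a geometric series. *)
Lemma schwartz_same_moments (phi : E -> R) (eta q : R) :
  test_fun phi -> 0 < eta -> 0 <= q -> q < D ->
  exists h : E -> R, [/\ smooth h, rapidly_decreasing h,
    forall x, `|h x| <= eta * (1 + `|x|) `^ (- q) &
    forall m, integrable_moment Ap k m h /\ M m h = M m phi].
Proof.
move=> tphi eta0 q0 qD.
have /choice[Hf hHf] : forall Nt : nat * (('I_d -> nat) -> R), exists h : E -> R,
  [/\ test_fun h /\ (forall x, `|x| < Nt.1.+1%:R -> h x = 0),
      forall x, `|h x| <= eta * 2^-1 ^+ Nt.1.+1 * (1 + `|x|) `^ (- q),
      forall s, (size s <= Nt.1)%N ->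
        forall x, (1 + `|x|) ^+ Nt.1 * `|iter_partial s h x| <= eta * 2^-1 ^+ Nt.1.+1 &
      (forall m, (degree m < Nt.1)%N -> M m h = 0) /\
      (forall m, degree m = Nt.1 -> M m h = Nt.2 m)].
  move=> [N t]; apply: (corrector k0 d0 u0) => //.
  by rewrite mulr_gt0// exprn_gt0.
(* the target of the n-th corrector is what is still missing after n steps *)
pose next n (f : E -> R) := Hf (n, fun m => M m phi - M m f).
pose S := fix S n : E -> R := if n is n'.+1 then
  (fun x => S n' x + next n' (S n') x) else (fun=> 0).
pose hh n := next n (S n).
have SS n : S n.+1 = (fun x => S n x + hh n x) by [].
have thh n : test_fun (hh n) by have [[]] := hHf (n, fun m => M m phi - M m (S n)).
have hh0 n (x : E) : `|x| < n.+1%:R -> hh n x = 0.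
  by have [[_ h] _ _ _] := hHf (n, fun m => M m phi - M m (S n)); exact: h.
have hhq n (x : E) : `|hh n x| <= eta * 2^-1 ^+ n.+1 * (1 + `|x|) `^ (- q).
  by have [_ h _ _] := hHf (n, fun m => M m phi - M m (S n)); exact: h.
have hhs n s (x : E) : (size s <= n)%N ->
    (1 + `|x|) ^+ n * `|iter_partial s (hh n) x| <= eta * 2^-1 ^+ n.+1.
  by move=> sn; have [_ _ h _] := hHf (n, fun m => M m phi - M m (S n)); exact: h.
have hhm n m : (degree m < n)%N -> M m (hh n) = 0.
  by move=> mn; have [_ _ _ [h _]] := hHf (n, fun m => M m phi - M m (S n)); exact: h.
have hhM n m : degree m = n -> M m (hh n) = M m phi - M m (S n).
  by move=> mn; have [_ _ _ [_ h]] := hHf (n, fun m => M m phi - M m (S n)); exact: h.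
have tS n : test_fun (S n).
  by elim: n => [|n ih]; [exact: test_fun0|rewrite SS; exact: test_fun_add].
have SE n : S n = (fun x => \sum_(0 <= j < n) hh j x).
  elim: n => [|n ih]; first by apply/funext => x; rewrite big_geq.
  by rewrite SS ih; apply/funext => x; rewrite big_nat_recr.
have MS n m : (degree m < n)%N -> M m (S n) = M m phi.
  elim: n => [//|n ih]; rewrite ltnS leq_eqVlt => /orP[/eqP mn|mn].
    rewrite SS momentD; try exact: integrable_moment_test.
    by rewrite hhM// addrC subrK.
  rewrite SS momentD; try exact: integrable_moment_test.
  by rewrite hhm// addr0 ih.
have Sstab n l (x : E) : (n <= l)%N -> `|x| < n%:R -> S l x = S n x.
  move=> nl xn; rewrite !SE (big_cat_nat (n := n))//= [X in _ + X]big_nat_cond.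
  rewrite [X in _ + X]big1 ?addr0// => j /andP[/andP[nj _] _].
  by apply: hh0; apply: lt_le_trans xn _; rewrite ler_nat (leq_trans nj).
pose h (x : E) := S (Num.trunc `|x|).+1 x.
have hS n (x : E) : `|x| < n%:R -> h x = S n x.
  move=> xn; rewrite /h; have xt : `|x| < (Num.trunc `|x|).+1%:R by exact: truncnS_gt.
  have [nt|tn] := leqP n (Num.trunc `|x|).+1; first exact: Sstab.
  by rewrite (Sstab _ _ _ (ltnW tn)).
have near_h n (x : E) : `|x| < n%:R -> \near x, h x = S n x.
  move=> xn; have : \forall y \near x, `|y| < n%:R.
    have := @norm_continuous _ _ x => /cvgr_lt; exact.
  by apply: filterS => y; exact: hS.
have sh : smooth h.
  apply: smooth_local => x; exists (S (Num.trunc `|x|).+1); first exact: (tS _).1.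
  by apply: near_h; exact: truncnS_gt.
have iter_h s n (x : E) : `|x| < n%:R -> iter_partial s h x = iter_partial s (S n) x.
  by move=> /near_h /(iter_partial_near s) /nbhs_singleton.
(* uniform in the number of terms: this serves both for the seminorms of the
sum and as the dominating function for the moments *)
have decay s J : exists2 C, 0 <= C & forall n (x : E),
    (1 + `|x|) ^+ J * `|iter_partial s (S n) x| <= C.
  (* from index j0 on, the corrector bound applies to s and to the weight J *)
  pose j0 := maxn J (size s).
  have /choice[C hC] : forall j, exists C, 0 <= C /\ forall x : E,
      (1 + `|x|) ^+ J * `|iter_partial s (hh j) x| <= C.
    move=> j; have [C C0 hC] := test_fun_decay J%:R s (thh j); exists C; split => // x.
    have x1 : 0 < 1 + `|x| by rewrite ltr_pwDl.
    by have := hC x; rewrite powRN powR_mulrn ?(ltW x1)// ler_pdivlMr ?exprn_gt0// mulrC.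
  exists (\sum_(0 <= j < j0) C j + eta).
    by rewrite addr_ge0 ?(ltW eta0)// sumr_ge0// => j _; exact: (hC j).1.
  move=> n x; rewrite SE iter_partial_sum; last by move=> j; exact: (thh j).1.
  pose a j := (1 + `|x|) ^+ J * `|iter_partial s (hh j) x|.
  have a0 j : 0 <= a j by rewrite mulr_ge0// exprn_ge0// addr_ge0.
  apply: (@le_trans _ _ (\sum_(0 <= j < n) a j)).
    by rewrite -mulr_sumr ler_wpM2l ?exprn_ge0 ?addr_ge0// ler_norm_sum.
  apply: (@le_trans _ _ (\sum_(0 <= j < j0 + n) a j)).
    rewrite [leRHS](big_cat_nat (n := n))//= ?leq_addl//.
    by rewrite lerDl sumr_ge0.
  rewrite (big_cat_nat (n := j0))//= ?leq_addr//; apply: lerD.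
    by apply: ler_sum => j _; exact: (hC j).2.
  apply: (@le_trans _ _ (\sum_(j0 <= j < j0 + n) eta * 2^-1 ^+ j.+1)).
    rewrite !big_nat; apply: ler_sum => j /andP[jj _].
    move: jj; rewrite /j0 geq_max => /andP[Jj sj].
    apply: le_trans (hhs j s x sj); rewrite /a ler_wpM2r// ler_weXn2l//.
    by rewrite lerDl.
  by rewrite -mulr_sumr ler_piMr ?(ltW eta0)// sum_halves_le1.
exists h; split => //.
- move=> m s; have [C C0 hC] := decay s (degree m); exists C => x.
  rewrite (iter_h s (Num.trunc `|x|).+1) ?truncnS_gt// normrM.
  apply: le_trans (hC (Num.trunc `|x|).+1 x).
  by apply: ler_wpM2r; rewrite ?norm_monomial.
- move=> x; rewrite /h SE; apply: le_trans (ler_norm_sum _ _ _) _.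
  apply: (@le_trans _ _ (\sum_(0 <= j < (Num.trunc `|x|).+1)
      (eta * (1 + `|x|) `^ (- q)) * 2^-1 ^+ j.+1)).
    by apply: ler_sum => j _; rewrite mulrAC hhq.
  by rewrite -mulr_sumr ler_piMr ?sum_halves_le1// mulr_ge0 ?powR_ge0// ltW.
move=> m.
pose J := (Num.trunc (D + (degree m)%:R)).+1.
have DJ : D + (degree m)%:R < J%:R by exact: truncnS_gt.
have [C C0 hC] := decay [::] J.
have SC n (x : E) : `|S n x| <= C * (1 + `|x|) `^ (- J%:R).
  have x1 : 0 < 1 + `|x| by rewrite ltr_pwDl.
  by rewrite powRN powR_mulrn ?(ltW x1)// ler_pdivlMr ?exprn_gt0// mulrC; exact: hC.
have mh : measurable_fun setT h.
  by apply: continuous_measurable_rV; exact: (@smooth_continuous _ _ h [::]).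
have ih : integrable_moment Ap k m h.
  by apply: (integrable_moment_decay k0 dim0 mh DJ) => x; exact: SC.
split => //.
pose G (x : E) := C * (1 + `|x|) `^ (- J%:R).
have mG : measurable_fun setT G by apply: measurable_funM => //; exact: measurable_decay.
have iG : integrable_moment Ap k m G.
  apply: (integrable_moment_decay (C := C) k0 dim0 mG DJ) => x.
  by rewrite ger0_norm// mulr_ge0// powR_ge0.
have mF (f : E -> R) : measurable_fun setT f ->
    measurable_fun setT (fun x => (monomial m x * f x * v x)%:E).
  move=> mf; apply/measurable_EFinP; apply: measurable_funM; last exact: measurable_dunkl_weight.
  by apply: measurable_funM => //; exact: measurable_monomial.
have SG x n : setT x -> (`|(monomial m x * S n x * v x)%:E| <=
    (abse \o (EFin \o (fun x => monomial m x * G x * v x)%R)) x)%E.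
  move=> _; rewrite /= lee_fin !normrM ler_wpM2r// ler_wpM2l//.
  by apply: le_trans (SC n x) _; apply: ler_pM; rewrite ?ler_norm ?powR_ge0.
have Sh x : setT x -> (fun n => (monomial m x * S n x * v x)%:E) @ \oo -->
    (monomial m x * h x * v x)%:E.
  move=> _; apply: cvg_near_cst; exists (Num.trunc `|x|).+1 => // n /= tn.
  rewrite (hS n)//; apply: lt_le_trans (truncnS_gt _) _.
  by rewrite ler_nat.
have [_ _] := dominated_convergence measurableT
  (fun n => mF _ (measurable_test_fun (tS n))) (mF _ mh)
  (aeW leb Sh) (integrable_abse iG) (aeW leb SG).
have Sm : \forall n \near \oo,
    (\int[leb]_x (monomial m x * S n x * v x)%:E = (M m phi)%:E)%E.
  exists (degree m).+1 => // n /= mn; rewrite -(MS n m mn) /moment /Rintegral fineK//.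
  exact/integrable_fin_num/integrable_moment_test.
move=> cv; have : [sequence \int[leb]_x (monomial m x * S n x * v x)%:E]_n%E @ \oo --> (M m phi)%:E.
  exact: cvg_near_cst.
move=> /(cvg_unique _ cv) => lim_eq.
by rewrite /moment /Rintegral lim_eq.
Qed.

End moment_matching.

(** * Density of vanishing moments, real case *)

Section schwartz_facts.
Context {R : realType} {d : nat}.
Local Notation E := 'rV[R]_d.
Implicit Types f g : E -> R.

Lemma rapidly_decreasing_add f g : smooth f -> smooth g ->
  rapidly_decreasing f -> rapidly_decreasing g ->
  rapidly_decreasing (fun x => f x + g x).
Proof.
move=> sf sg rf rg n s; have [C hC] := rf n s; have [B hB] := rg n s.
exists (C + B) => x; rewrite iter_partial_add// mulrDr.
by apply: le_trans (ler_normD _ _) _; rewrite lerD.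
Qed.

Lemma rapidly_decreasing_scale (c : R) f : smooth f ->
  rapidly_decreasing f -> rapidly_decreasing (fun x => c * f x).
Proof.
move=> sf rf n s; have [C hC] := rf n s; exists (`|c| * C) => x.
by rewrite iter_partial_scale// mulrCA normrM ler_wpM2l.
Qed.

Lemma rapidly_decreasing_test f : test_fun f -> rapidly_decreasing f.
Proof.
move=> tf n s; have [C C0 hC] := test_fun_decay (degree n)%:R s tf; exists C => x.
have x1 : 0 < 1 + `|x| by rewrite ltr_pwDl.
have := hC x; rewrite powRN powR_mulrn ?(ltW x1)// ler_pdivlMr ?exprn_gt0// => h.
apply: le_trans h; rewrite normrM mulrC ler_wpM2l//.
exact: norm_monomial.
Qed.

(** The seminorms only bound monomials times the function; the monomials
x_i^J control |x|^J because the sup norm is attained at a coordinate. *)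
Lemma rapid_decay f (J : nat) : rapidly_decreasing f ->
  exists2 C, 0 <= C & forall x, `|f x| <= C * (1 + `|x|) `^ (- J%:R).
Proof.
move=> rf.
have /choice[C hC] : forall i : 'I_d, exists C : R, forall x : E, `|x ord0 i| ^+ J * `|f x| <= C.
  move=> i; have [C hC] := rf (fun j => if j == i then J else 0%N) [::].
  exists C => x; apply: le_trans (hC x); rewrite normrM /= ler_wpM2r//.
  rewrite /monomial (bigD1 i)//= eqxx big1 ?mulr1 ?normrX//.
  by move=> j /negbTE ->.
have [C0 hC0] := rf (fun=> 0%N) [::].
have {}hC0 x : `|f x| <= C0.
  by apply: le_trans (hC0 x); rewrite /monomial big1 ?mul1r.
pose B := `|C0| + \sum_i `|C i|.
have B0 : 0 <= B by rewrite addr_ge0// sumr_ge0.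
exists (2 ^+ J * B) => [|x]; first by rewrite mulr_ge0// exprn_ge0.
have x1 : 0 < 1 + `|x| by rewrite ltr_pwDl.
rewrite powRN powR_mulrn ?(ltW x1)// ler_pdivlMr ?exprn_gt0//.
have [xle1|xgt1] := leP `|x| 1.
  apply: (@le_trans _ _ (C0 * 2 ^+ J)).
    apply: ler_pM; rewrite ?exprn_ge0 ?(ltW x1)//.
    by rewrite lerXn2r ?nnegrE ?(ltW x1)//; lra.
  rewrite mulrC ler_wpM2l ?exprn_ge0//.
  by rewrite (le_trans (ler_norm C0))// lerDl sumr_ge0.
have [i xi] : exists i, `|x| = `|x ord0 i|.
  have /mx_norm_neq0[[i j] /= h] : mx_norm x != 0.
    by rewrite gt_eqF// (lt_trans _ xgt1).
  by exists j; move: h; rewrite ord1.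
apply: (@le_trans _ _ (`|f x| * (2 ^+ J * `|x| ^+ J))).
  rewrite ler_wpM2l// -exprMn lerXn2r ?nnegrE ?(ltW x1) ?mulr_ge0//; lra.
rewrite mulrCA ler_wpM2l ?exprn_ge0// mulrC {1}xi.
apply: le_trans (hC i x) _; apply: le_trans (ler_norm _) _.
rewrite /B (bigD1 i)//=; have : 0 <= \sum_(j | j != i) `|C j| by exact: sumr_ge0.
by have := normr_ge0 C0; lra.
Qed.

End schwartz_facts.

Section dunkl_density.
Context {R : realType} {d : nat}.
Local Notation E := 'rV[R]_d.
Local Notation leb := (@lebesgue_rV R d).
Variables (Ap : {fset E}) (k : E -> R) (u : E) (p s q : R).
Hypothesis k0 : forall a, a \in Ap -> 0 <= k a.
Hypothesis d0 : (0 < d)%N.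
Hypothesis u0 : forall a, a \in Ap -> dot u a != 0.
Hypothesis p1 : 1 <= p.
Local Notation v := (dunkl_weight Ap k).
Local Notation c := (dunkl_const Ap k).
Local Notation M := (moment Ap k).
Local Notation D := (dunkl_dim Ap k).
Hypotheses (Ds : - D < s) (q0 : 0 <= q) (qD : q < D) (sq : s + D < p * q).
Local Notation nu := (power_dunkl_measure Ap k s).
Local Notation Lp := (Lp_norm nu p).

Let p0 : 0 < p. Proof. exact: lt_le_trans p1. Qed.
Let dim0 : 0 < D := dunkl_dim_gt0 k0 d0.

Let ge0_integral_nu (F : E -> R) : measurable_fun setT F -> (forall x, 0 <= F x) ->
  (\int[nu]_x (F x)%:E = \int[leb]_x (F x * enorm x `^ s * (c * v x))%:E)%E.
Proof.
move=> mF F0; have mF' : measurable_fun setT (EFin \o F) by exact/measurable_EFinP.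
rewrite /power_dunkl_measure ge0_integral_with_density//.
rewrite /dunkl_measure; under eq_integral do rewrite -EFinM.
rewrite ge0_integral_with_density//.
  by apply/measurable_EFinP; apply: measurable_funM => //; exact: measurable_enorm_powR.
by move=> x; rewrite lee_fin mulr_ge0 ?powR_ge0.
Qed.

Let wint := (\int[leb]_x (enorm x `^ s * v x * (1 + `|x|) `^ (- (p * q)))%:E)%E.
Let K : R := c * fine wint.

Let wint_fin : wint \is a fin_num.
Proof.
rewrite ge0_fin_numE; first exact: integral_enorm_weight_lty.
by apply: integral_ge0 => x _; rewrite lee_fin !mulr_ge0 ?powR_ge0 ?dunkl_weight_ge0.
Qed.

Let K0 : 0 <= K.
Proof.
rewrite mulr_ge0 ?dunkl_const_ge0// fine_ge0//.
by apply: integral_ge0 => x _; rewrite lee_fin !mulr_ge0 ?powR_ge0 ?dunkl_weight_ge0.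
Qed.

(* All functions below are compared with the decay rate q: the hypothesis on s
and q makes this rate admissible both at the origin and at infinity. *)
Let integral_decay (f : E -> R) (C : R) : measurable_fun setT f -> 0 <= C ->
  (forall x, `|f x| <= C * (1 + `|x|) `^ (- q)) ->
  (\int[nu]_x (`|f x| `^ p)%:E <= (C `^ p * K)%:E)%E.
Proof.
move=> mf C0 fC.
have mp : measurable_fun setT (fun x => `|f x| `^ p).
  by apply: (measurableT_comp (measurable_powR p)); exact: measurableT_comp.
rewrite ge0_integral_nu//.
pose w (x : E) := enorm x `^ s * v x * (1 + `|x|) `^ (- (p * q)).
have mw : measurable_fun setT w.
  apply: measurable_funM; last exact: measurable_decay.
  by apply: measurable_funM; [exact: measurable_enorm_powR|exact: measurable_dunkl_weight].
have w0 x : 0 <= w x by rewrite !mulr_ge0 ?powR_ge0 ?dunkl_weight_ge0.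
have cC0 : 0 <= C `^ p * c by rewrite mulr_ge0 ?powR_ge0 ?dunkl_const_ge0.
apply: (@le_trans _ _ (\int[leb]_x ((C `^ p * c)%:E * (w x)%:E))%E).
  apply: ge0_le_integral.
  - exact: measurableT.
  - by move=> x _; rewrite lee_fin !mulr_ge0 ?powR_ge0 ?dunkl_weight_ge0 ?dunkl_const_ge0.
  - apply/measurable_EFinP; apply: measurable_funM; last exact: measurable_dunkl_density.
    by apply: measurable_funM => //; exact: measurable_enorm_powR.
  - by apply: measurable_funeM; exact/measurable_EFinP.
  move=> x _; rewrite -EFinM lee_fin /w.
  have x1 : 0 <= 1 + `|x| by rewrite addr_ge0.
  have fp : `|f x| `^ p <= C `^ p * (1 + `|x|) `^ (- (p * q)).
    have -> : (1 + `|x|) `^ (- (p * q)) = ((1 + `|x|) `^ (- q)) `^ p.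
      by rewrite -powRrM mulNr (mulrC p).
    rewrite -powRM ?powR_ge0//; apply: ge0_ler_powR; rewrite ?nnegrE ?(ltW p0)//.
    by rewrite mulr_ge0 ?powR_ge0.
  rewrite -mulrA; apply: le_trans (ler_wpM2r _ fp) _.
    by rewrite !mulr_ge0 ?powR_ge0 ?dunkl_const_ge0 ?dunkl_weight_ge0.
  by rewrite le_eqVlt; apply/orP; left; apply/eqP; ring.
rewrite ge0_integralZl//.
- by rewrite -[X in (_ * X)%E]/wint -(fineK wint_fin) -EFinM lee_fin mulrA.
- exact/measurable_EFinP.
- by move=> x _; rewrite lee_fin.
Qed.

Let nu_cube n : (nu (cube n) < +oo)%E.
Proof.
have mc : measurable (@cube R d n) by exact: measurable_open_box.
rewrite -[X in nu X]setIT -integral_indic//.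
have C0 : 0 <= (1 + n%:R : R) `^ q by exact: powR_ge0.
apply: (@le_lt_trans _ _ (((1 + n%:R : R) `^ q) `^ p * K)%:E); last exact: ltry.
apply: le_trans (integral_decay (f := \1_(cube n)) _ C0 _); last 2 first.
- exact: measurable_indic.
- move=> x; rewrite indicE; case: (boolP (x \in _)) => [|_]; last first.
    by rewrite normr0 mulr_ge0 ?powR_ge0.
  rewrite inE normr1 => xc; rewrite powRN ler_pdivlMr ?powR_gt0 ?ltr_pwDl// mul1r.
  apply: ge0_ler_powR; rewrite ?nnegrE ?addr_ge0// lerD2l.
  apply/norm_rV_le => // i; rewrite ler_norml.
  by have /andP[/ltW -> /ltW ->] := xc i.
rewrite le_eqVlt; apply/orP; left; apply/eqP; apply: eq_integral => x _.
rewrite indicE; case: (x \in _); first by rewrite normr1 powR1.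
by rewrite normr0 powR0// gt_eqF.
Qed.

(** Approximate f by a test function, then subtract a Schwartz function with the
same moments; its norm is at most eta K^(1/p). *)
Lemma dense_vanishing_moments (f : E -> R) (e : R) : measurable_fun setT f ->
  (\int[nu]_x (`|f x| `^ p)%:E < +oo)%E -> 0 < e ->
  exists g : E -> R, [/\ smooth g, rapidly_decreasing g,
    (forall m, integrable_moment Ap k m g /\ M m g = 0) &
    (Lp (fun x => (f x - g x)%R) < e%:E)%E].
Proof.
move=> mf fp e0; have e20 : 0 < e / 2 by rewrite divr_gt0.
have [_ /(_ _ e20)[phi tphi fphi]] := test_fun_dense p1 nu_cube mf fp.
pose eta := e / 2 / (K + 1) `^ p^-1.
have K1 : 0 < K + 1 by rewrite ltr_wpDl.
have eta0 : 0 < eta by rewrite divr_gt0// powR_gt0.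
have [h [sh rh hq hM]] := schwartz_same_moments k0 d0 u0 tphi eta0 q0 qD.
have mh : measurable_fun setT h.
  by apply: continuous_measurable_rV; exact: (@smooth_continuous _ _ h [::]).
have mphi := measurable_test_fun tphi.
have h_small : (Lp h < (e / 2)%:E)%E.
  apply: Lp_norm_lt => //; apply: le_lt_trans (integral_decay mh (ltW eta0) hq) _.
  rewrite lte_fin /eta powRM ?(ltW e20) ?invr_ge0 ?powR_ge0//.
  have -> : ((K + 1) `^ p^-1)^-1 `^ p = (K + 1)^-1.
    rewrite -powR_inv1 ?powR_ge0// -!powRrM mulN1r mulrN mulVf ?gt_eqF//.
    by rewrite powR_inv1 ?(ltW K1).
  by rewrite -mulrA gtr_pMr ?powR_gt0// mulrC ltr_pdivrMr// mul1r ltrDl.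
exists (fun x => phi x + -1 * h x); split.
- by apply: smooth_add; [exact: tphi.1|exact: smooth_scale].
- apply: rapidly_decreasing_add; [exact: tphi.1|exact: smooth_scale| |].
    exact: rapidly_decreasing_test.
  exact: rapidly_decreasing_scale.
- move=> m; have [ih Mh] := hM m.
  have iphi := integrable_moment_test k0 dim0 m tphi.
  have inh : integrable_moment Ap k m (fun x => -1 * h x).
    rewrite /integrable_moment (_ : _ \o _ =
      (fun x => (-1)%:E * (EFin \o (fun x => (monomial m x * h x * v x)%R)) x)%E).
      exact: integrableZl.
    by apply/funext => x /=; rewrite -EFinM; congr EFin; ring.
  split.
    rewrite /integrable_moment (_ : _ \o _ =
      (EFin \o (fun x => (monomial m x * phi x * v x)%R)) \+
      (EFin \o (fun x => (monomial m x * (-1 * h x) * v x)%R)))%E.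
      exact: integrableD.
    by apply/funext => x /=; rewrite -EFinD; congr EFin; ring.
  by rewrite momentD// momentZ// Mh mulN1r subrr.
rewrite (_ : (fun x => _) = (fun x => (f x - phi x) + h x)); last first.
  by apply/funext => x; rewrite mulN1r opprD opprK addrA.
have mfp : measurable_fun setT (fun x => f x - phi x) by exact: measurable_funB.
apply: le_lt_trans (Lp_norm_triangle nu p1 mfp mh) _.
by rewrite (splitr e) EFinD; apply: lteD.
Qed.

Lemma Lp_norm_schwartz (f : E -> R) : smooth f -> rapidly_decreasing f ->
  measurable_fun setT f /\ (\int[nu]_x (`|f x| `^ p)%:E < +oo)%E.
Proof.
move=> sf rf.
have mf : measurable_fun setT f.
  by apply: continuous_measurable_rV; exact: (@smooth_continuous _ _ f [::]).
split => //; have [C C0 hC] := rapid_decay (Num.trunc q).+1 rf.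
apply: (@le_lt_trans _ _ (C `^ p * K)%:E); last exact: ltry.
apply: integral_decay => // x; apply: le_trans (hC x) _.
rewrite ler_wpM2l// ler_powR//; first by rewrite lerDl.
by rewrite lerN2 ltW// truncnS_gt.
Qed.

End dunkl_density.

(** * Density of vanishing moments, complex case *)

Section complex_reduction.
Context {R : realType} {d : nat}.
Local Notation E := 'rV[R]_d.
Variables (nu : {measure set E -> \bar R}) (p : R).
Hypothesis p1 : 1 <= p.
Local Notation Lp := (Lp_norm nu p).

Lemma Lp_norm_le (f g : E -> R) : measurable_fun setT f -> measurable_fun setT g ->
  (forall x, `|f x| <= `|g x|) -> (Lp f <= Lp g)%E.
Proof.
move=> mf mg fg; rewrite !Lp_normE.
have p0 : 0 < p by exact: lt_le_trans p1.
have mp (h : E -> R) : measurable_fun setT h -> measurable_fun setT (fun x : E => (`|h x| `^ p)%:E).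
  move=> mh; apply/measurable_EFinP; apply: (measurableT_comp (measurable_powR p)).
  exact: measurableT_comp.
have ge0 (h : E -> R) : (0 <= \int[nu]_x (`|h x| `^ p)%:E)%E.
  by apply: integral_ge0 => x _; rewrite lee_fin powR_ge0.
apply: gt0_ler_poweR; rewrite ?invr_ge0 ?(ltW p0)//.
- by rewrite in_itv /= leey ge0.
- by rewrite in_itv /= leey ge0.
apply: ge0_le_integral.
- exact: measurableT.
- by move=> x _; rewrite lee_fin powR_ge0.
- exact: mp.
- exact: mp.
by move=> x _; rewrite lee_fin; apply: ge0_ler_powR; rewrite ?nnegrE ?(ltW p0).
Qed.

Lemma Lp_norm_lty (f : E -> R) :
  (Lp f < +oo)%E = (\int[nu]_x (`|f x| `^ p)%:E < +oo)%E.
Proof.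
have p0 : 0 < p by exact: lt_le_trans p1.
rewrite Lp_normE; apply/idP/idP; last exact: poweR_lty.
by apply: lty_poweRy; rewrite invr_neq0// gt_eqF.
Qed.

Local Notation Re f := (fun x => complex.Re (f x)).
Local Notation Im f := (fun x => complex.Im (f x)).

Lemma complex_LnormE (f : E -> R[i]) :
  complex_Lnorm nu p f = Lp (fun x => ComplexField.Normc.normc (f x)).
Proof. by []. Qed.

Lemma measurable_normc (f : E -> R[i]) : measurable_fun setT (Re f) ->
  measurable_fun setT (Im f) ->
  measurable_fun setT (fun x => ComplexField.Normc.normc (f x)).
Proof.
move=> mr mi; rewrite (_ : (fun x => _) =
    (fun x => Num.sqrt (complex.Re (f x) ^+ 2 + complex.Im (f x) ^+ 2))).
  apply: (measurableT_comp (f := @Num.sqrt R)).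
    by apply: continuous_measurable_fun; exact: sqrt_continuous.
  by apply: measurable_funD; exact: measurable_funX.
by apply/funext => x; case: (f x).
Qed.

Lemma normc_ge_Re (z : R[i]) : `|complex.Re z| <= ComplexField.Normc.normc z.
Proof. by case: z => a b /=; rewrite -sqrtr_sqr ler_wsqrtr// lerDl sqr_ge0. Qed.

Lemma normc_ge_Im (z : R[i]) : `|complex.Im z| <= ComplexField.Normc.normc z.
Proof. by case: z => a b /=; rewrite -sqrtr_sqr ler_wsqrtr// lerDr sqr_ge0. Qed.

Lemma normc_le (z : R[i]) :
  ComplexField.Normc.normc z <= `|complex.Re z| + `|complex.Im z|.
Proof.
case: z => a b /=; rewrite -[leRHS]ger0_norm ?addr_ge0// -sqrtr_sqr ler_wsqrtr//.
rewrite sqrrD !real_normK ?num_real// lerD2r lerDl.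
by rewrite mulrn_wge0// mulr_ge0.
Qed.

Lemma normc_ge0 (z : R[i]) : 0 <= ComplexField.Normc.normc z.
Proof. by case: z => a b /=; exact: sqrtr_ge0. Qed.

Lemma complex_Lnorm_le (f : E -> R[i]) : measurable_fun setT (Re f) ->
  measurable_fun setT (Im f) -> (complex_Lnorm nu p f <= Lp (Re f) + Lp (Im f))%E.
Proof.
move=> mr mi; rewrite complex_LnormE.
have nE (h : E -> R) : measurable_fun setT h -> Lp (fun x => `|h x|) = Lp h.
  by move=> mh; rewrite !Lp_normE; under eq_integral do rewrite normr_id.
rewrite -(nE _ mr) -(nE _ mi).
have mr' : measurable_fun setT (fun x => `|complex.Re (f x)|) by exact: measurableT_comp.
have mi' : measurable_fun setT (fun x => `|complex.Im (f x)|) by exact: measurableT_comp.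
apply: le_trans (Lp_norm_triangle nu p1 mr' mi').
apply: Lp_norm_le.
- exact: measurable_normc.
- exact: measurable_funD.
move=> x; rewrite (ger0_norm (normc_ge0 _)) [leRHS]ger0_norm ?addr_ge0//.
exact: normc_le.
Qed.

End complex_reduction.

Theorem theorem6p3 (R : realType) (d : nat) (A Ap : {fset 'rV[R]_d})
    (k : 'rV[R]_d -> R) (p beta : R) :
  (0 < d)%N ->
  root_system A -> positive_subsystem A Ap -> multiplicity A k ->
  1 < p ->
  - (dunkl_dim Ap k / p) < beta -> beta < dunkl_dim Ap k / conj_exponent p ->
  dense_in_Lp (power_dunkl_measure Ap k (beta * p)) p (Phi Ap k).
Proof.
move=> d0 _ [u [uA ApE]] [kA _] p1 lo hi.
have ApA a : a \in Ap -> a \in A.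
  by move=> aAp; have : [set` Ap] a by []; rewrite ApE => -[].
have k0 a : a \in Ap -> 0 <= k a by move=> /ApA /kA.
have u0 a : a \in Ap -> dot u a != 0 by move=> /ApA /uA.
have dim0 := dunkl_dim_gt0 k0 d0.
have p0 : 0 < p by lra.
set D := dunkl_dim Ap k in lo hi dim0 *.
set s := beta * p.
have Ds : - D < s by rewrite -ltr_pdivrMr// mulNr.
have hiE : D / conj_exponent p = D - D / p.
  by rewrite /conj_exponent; field; rewrite !gt_eqF//; lra.
(* a decay rate q that makes the weighted Lp norm finite at infinity but is
slower than the homogeneous dimension *)
pose q := (beta + D / p + D) / 2.
have q0 : 0 <= q by rewrite /q; lra.
have qD : q < D by rewrite /q; lra.
have sq : s + D < p * q.
  have -> : s + D = p * (beta + D / p) by rewrite /s; field; rewrite gt_eqF.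
  by rewrite ltr_pM2l// /q; lra.
have p1' := ltW p1.
set nu := power_dunkl_measure Ap k s.
have schw (f : 'rV[R]_d -> R) : smooth f -> rapidly_decreasing f ->
    measurable_fun setT f /\ (\int[nu]_x (`|f x| `^ p)%:E < +oo)%E.
  move=> sf rf; exact: (Lp_norm_schwartz k0 p1' Ds sq sf rf).
split.
  move=> f [[sr rr si ri] _].
  have [mr fr] := schw _ sr rr; have [mi fi] := schw _ si ri.
  split => //; apply: le_lt_trans (complex_Lnorm_le nu p1' mr mi) _.
  by apply: lte_add_pinfty; rewrite Lp_norm_lty.
move=> f [mr mi fp] e e0; have e20 : 0 < e / 2 by rewrite divr_gt0.
have mn := measurable_normc mr mi.
have fr : (\int[nu]_x (`|complex.Re (f x)| `^ p)%:E < +oo)%E.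
  rewrite -Lp_norm_lty//; apply: le_lt_trans fp; rewrite complex_LnormE.
  apply: Lp_norm_le => // x; rewrite (ger0_norm (normc_ge0 _)); exact: normc_ge_Re.
have fi : (\int[nu]_x (`|complex.Im (f x)| `^ p)%:E < +oo)%E.
  rewrite -Lp_norm_lty//; apply: le_lt_trans fp; rewrite complex_LnormE.
  apply: Lp_norm_le => // x; rewrite (ger0_norm (normc_ge0 _)); exact: normc_ge_Im.
have [gr [sgr rgr Mgr fgr]] := dense_vanishing_moments k0 d0 u0 p1' Ds q0 qD sq mr fr e20.
have [gi [sgi rgi Mgi fgi]] := dense_vanishing_moments k0 d0 u0 p1' Ds q0 qD sq mi fi e20.
have mgr : measurable_fun setT gr by have [] := schw _ sgr rgr.
have mgi : measurable_fun setT gi by have [] := schw _ sgi rgi.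
have dunkl_moment (n : 'I_d -> nat) (g : 'rV[R]_d -> R) : measurable_fun setT g ->
    integrable_moment Ap k n g -> moment Ap k n g = 0 ->
    Rintegral (dunkl_measure Ap k) setT (fun x => monomial n x * g x) = 0.
  move=> mg ig Mg; rewrite /dunkl_measure Rintegral_with_density; last first.
    by apply: measurable_funM => //; exact: measurable_monomial.
  transitivity (dunkl_const Ap k * moment Ap k n g); last by rewrite Mg mulr0.
  rewrite /moment -RintegralZl//; apply: eq_Rintegral => x _.
  by rewrite mulrCA mulrA.
exists (fun x => Complex (gr x) (gi x)).
  split; first by split.
  move=> n; have [ir Mr] := Mgr n; have [ii Mi] := Mgi n.
  rewrite /complex_integral /=.
  rewrite (_ : (fun x => monomial n x * gr x - 0 * gi x) =
      (fun x => monomial n x * gr x)); last first.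
    by apply/funext => x; rewrite mul0r subr0.
  rewrite (_ : (fun x => monomial n x * gi x + 0 * gr x) =
      (fun x => monomial n x * gi x)); last first.
    by apply/funext => x; rewrite mul0r addr0.
  by rewrite !dunkl_moment.
have reE : (fun x => complex.Re (f x - Complex (gr x) (gi x))) =
    (fun x => complex.Re (f x) - gr x).
  by apply/funext => x; case: (f x).
have imE : (fun x => complex.Im (f x - Complex (gr x) (gi x))) =
    (fun x => complex.Im (f x) - gi x).
  by apply/funext => x; case: (f x).
apply: le_lt_trans (complex_Lnorm_le nu p1' _ _) _.
- by rewrite reE; exact: measurable_funB.
- by rewrite imE; exact: measurable_funB.
by rewrite reE imE (splitr e) EFinD; apply: lteD.
Qed.
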